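(* Let $\Omega\subset\mathbb{R}^n$ be a proper, open, nonempty subset, let $1<p\le q<\infty$ and $0<\beta<1$. Let $(u,v)$ be a pair of weights such that $\sigma=v^{-1/(p-1)}\in D_\beta$. Assume in addition that $u\in D_\beta$ and $\sigma\in A_\infty^\beta$. Then $M_\beta$ is bounded from $L^p(v)$ to $L^q(u)$ if and only if $(u,v)\in \mathrm{A}_{p,q}^\beta$.
   Context: Cubes have sides parallel to the axes; $Q(x,l)$ is the cube with center $x$ and half side length $l>0$. $\mathrm{d}$ is the $d_\infty$ metric on $\mathbb{R}^n$, and $\mathrm{d}(x,\Omega^c)$ the corresponding distance to $\Omega^c=\mathbb{R}^n\setminus\Omega$. $\mathcal{F}_\beta=\{Q(x,l): x\in\Omega,\ l<\beta\,\mathrm{d}(x,\Omega^c)\}$. A weight is a nonnegative locally integrable function on $\Omega$; for a weight $w$ write $w(E)=\int_E w\,dx$, and $L^p(w)$ is the space of measurable $f$ on $\Omega$ with $\int_\Omega|f|^p w\,dx<\infty$. A weight $w$ belongs to $D_\beta$ if there is a constant $C_\beta$ such that $w(2Q)\le C_\beta\,w(Q)<\infty$ for every cube $Q\in\mathcal{F}_\beta$ such that $2Q\in\mathcal{F}_\beta$ ($2Q$ is the cube concentric with $Q$ with twice its side length). A weight $w$ belongs to $A_\infty^\beta$ if there are positive constants $c,\delta$ such that $\frac{w(E)}{w(Q)}\le c\left(\frac{|E|}{|Q|}\right)^\delta$ for every cube $Q\in\mathcal{F}_\beta$ and every measurable $E\subset Q$. For $1<p\le q<\infty$, $(u,v)\in\mathrm{A}_{p,q}^\beta$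 means that there is a constant $C$ such that $\frac{u(Q)^{p/q}}{|Q|}\left(\frac{\sigma(Q)}{|Q|}\right)^{p-1}\le C$ for every cube $Q\in\mathcal{F}_\beta$, where $\sigma=v^{-1/(p-1)}$. For $x\in\Omega$ and a locally integrable $f$ on $\Omega$, $M_\beta f(x)=\sup_{x\in Q\in\mathcal{F}_\beta}\frac1{|Q|}\int_Q|f(y)|\,dy$. An operator $T$ is bounded from $L^p(v)$ to $L^q(u)$ if there is a constant $C$ with $\left(\int_\Omega |Tf|^q u\,dx\right)^{1/q}\le C\left(\int_\Omega|f|^p v\,dx\right)^{1/p}$ for all $f\in L^p(v)$. *)

(* Defs.v *)
From HB Require Import structures.
From mathcomp Require Export all_boot all_order all_algebra.
From mathcomp Require Export all_classical all_reals all_analysis.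
From mathcomp Require Export measurable_realfun.

Set Implicit Arguments.
Unset Strict Implicit.
Unset Printing Implicit Defensive.

Import Order.TTheory GRing.Theory Num.Theory.
Import numFieldNormedType.Exports.

Local Open Scope classical_set_scope.
Local Open Scope ring_scope.

(* R^n, n >= 1, is 'rV[R]_n.+1: its norm is the sup norm, so that `|x - y|
   is the d_oo distance. *)

Section lebesgue_rV.
Context {R : realType} {n : nat}.
Local Notation V := 'rV[R]_n.+1.

Definition box (ab : V * V) : set V :=
  [set x | forall i, ab.1 ord0 i < x ord0 i <= ab.2 ord0 i].

Definition box_vol (ab : V * V) : R :=
  \prod_(i < n.+1) Num.max 0 (ab.2 ord0 i - ab.1 ord0 i).

Local Open Scope ereal_scope.

Definition lebesgue_outer (A : set V) : \bar R :=
  ereal_inf [set \sum_(k <oo) (box_vol (B k))%:E |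
             B in [set B : (V * V)^nat | A `<=` \bigcup_k box (B k)]].

Lemma box_vol_ge0 ab : 0 <= (box_vol ab)%:E.
Proof. by rewrite lee_fin prodr_ge0// => i _; rewrite le_max lexx. Qed.

Let lebesgue_outer_ge0 A : 0 <= lebesgue_outer A.
Proof.
apply: le_ereal_inf_tmp => _ [B _ <-].
by apply: nneseries_ge0 => k _ _; exact: box_vol_ge0.
Qed.

Let lebesgue_outer0 : lebesgue_outer set0 = 0.
Proof.
apply/eqP; rewrite eq_le lebesgue_outer_ge0 andbT.
apply: ereal_inf_lbound; exists (fun=> (0%R, 0%R)); first by [].
by apply: eseries0 => k _ _; rewrite /box_vol/= big_ord_recl subrr maxxx mul0r.
Qed.

Let le_lebesgue_outer : {homo lebesgue_outer : A B / A `<=` B >-> A <= B}.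
Proof.
move=> A B AB; apply/ereal_inf_le_tmp => _ [C /= BC <-].
by exists C => //; exact: subset_trans AB BC.
Qed.

Let lebesgue_outer_sigma_subadditive : sigma_subadditive lebesgue_outer.
Proof.
move=> A; have [[i ioo]|] := pselect (exists i, lebesgue_outer (A i) = +oo).
  rewrite (eseries_pinfty _ _ ioo) ?leey// => k _.
  by rewrite -ltNye (lt_le_trans _ (lebesgue_outer_ge0 _)).
rewrite -forallNE => Aoo.
suff add2e (e : {posnum R}) : lebesgue_outer (\bigcup_k A k) <=
    \sum_(i <oo) lebesgue_outer (A i) + e%:num%:E.
  by apply/lee_addgt0Pr => _/posnumP[].
rewrite (le_trans _ (epsilon_trick _ _ _))//.
pose P i (B : (V * V)^nat) := A i `<=` \bigcup_k box (B k) /\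
  \sum_(k <oo) (box_vol (B k))%:E <=
  lebesgue_outer (A i) + (e%:num / (2 ^ i.+1)%:R)%:E.
have [G PG] : {G : ((V * V)^nat)^nat & forall i, P i (G i)}.
  apply: (@choice _ _ P) => i.
  have Afin : lebesgue_outer (A i) \is a fin_num.
    by rewrite ge0_fin_numE// ltey; exact/eqP.
  have e0 : (0 < e%:num / (2 ^ i.+1)%:R)%R by [].
  have [_ [B AB <-] muB] := lb_ereal_inf_adherent e0 Afin.
  by exists B; split => //; exact/ltW.
have vol_ge0 x : 0 <= (EFin \o box_vol \o uncurry G) x by exact: box_vol_ge0.
apply: (@le_trans _ _ (\esum_(i in setT) (EFin \o box_vol \o uncurry G) i)).
  apply: ereal_inf_lbound => /=.
  have /card_esym/ppcard_eqP[f] := card_nat2.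
  exists (uncurry G \o f).
    move=> t [i _] /(PG i).1[j _ Gij].
    by exists (f^-1%FUN (i, j)) => //=; rewrite invK ?inE.
  rewrite -(esum_pred_image (EFin \o box_vol \o uncurry G) _ xpredT) ?[fun=> _]set_true//.
  by rewrite image_eq.
rewrite (_ : esum _ _ = \sum_(i <oo) \sum_(j <oo) (box_vol (G i j))%:E); last first.
  pose J : nat -> set (nat * nat) := fun i => [set (i, j) | j in setT].
  rewrite (_ : setT = \bigcup_k J k); last first.
    by rewrite predeqE => -[a b]; split => // _; exists a => //; exists b.
  rewrite esum_bigcupT /=; last 2 first.
    - by move=> i j _ _ [_ [[? _ <-] [? _ [->]]]].
    - by move=> x; exact: box_vol_ge0.
  rewrite -(image_id [set: nat]) -fun_true esum_pred_image//; last first.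
    by move=> k _; apply: esum_ge0 => ? _; exact: box_vol_ge0.
  apply: eq_eseriesr => /= j _.
  rewrite -(esum_pred_image (EFin \o box_vol \o uncurry G) (pair j) predT)/=; last 2 first.
    - by move=> ? _; exact: box_vol_ge0.
    - by move=> ? ? _ _; exact: (@can_inj _ _ _ snd).
  by congr esum; rewrite predeqE => -[a b]; split; move=> [i _ <-]; exists i.
apply: lee_nneseries => [i _ _|i _]; last exact: (PG i).2.
by apply: nneseries_ge0 => j _ _; exact: box_vol_ge0.
Qed.

HB.instance Definition _ := isOuterMeasure.Build R V lebesgue_outer
  lebesgue_outer0 lebesgue_outer_ge0 le_lebesgue_outer
  lebesgue_outer_sigma_subadditive.

End lebesgue_rV.

(* R^n with the sigma-algebra of Lebesgue measurable sets, i.e. the sets that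
   are Caratheodory measurable for the outer measure. *)
Definition leb_rV (R : realType) (n : nat) : Type :=
  caratheodory_type (@lebesgue_outer R n).
HB.instance Definition _ R n := Measurable.on (leb_rV R n).

Definition lebesgue_rV {R : realType} {n : nat} : set (leb_rV R n) -> \bar R :=
  @lebesgue_outer R n.
HB.instance Definition _ (R : realType) (n : nat) :=
  isMeasure.Build _ _ _ (@lebesgue_rV R n)
    (@caratheodory_measure0 _ _ (@lebesgue_outer R n))
    (@caratheodory_measure_ge0 _ _ (@lebesgue_outer R n))
    (@caratheodory_measure_sigma_additive _ _ (@lebesgue_outer R n)).

Section weights.
Context {R : realType} {n : nat}.
Local Notation V := 'rV[R]_n.+1.
Local Notation mu := (@lebesgue_rV R n).
Implicit Types (Omega E : set V) (Q : V * R) (w u v : V -> \bar R).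

Definition dist_compl Omega (x : V) : R := inf [set `|x - y| | y in ~` Omega].

(* The pair (x, l) stands for the cube Q(x, l); cubes are open, being the balls
   of the sup norm. *)
Definition cube Q : set V := ball Q.1 Q.2.

Definition double_cube Q : V * R := (Q.1, 2 * Q.2).

Definition cubes Omega (beta : R) : set (V * R) :=
  [set Q | Omega Q.1 /\ 0 < Q.2 < beta * dist_compl Omega Q.1].

Local Open Scope ereal_scope.

Definition wmeas w E : \bar R := \int[mu]_(x in E) w x.

(* Weights may take the value +oo (necessarily on a null set), as
   v^(-1/(p-1)) does where v vanishes. *)
Definition weight Omega w :=
  [/\ measurable_fun (Omega : set (leb_rV R n)) w,
      forall x, Omega x -> 0 <= w x &
      forall K, K `<=` Omega -> compact K -> wmeas w K < +oo].

Definition D_class Omega (beta : R) w :=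
  weight Omega w /\
  exists C : R, forall Q, cubes Omega beta Q ->
    cubes Omega beta (double_cube Q) ->
    wmeas w (cube (double_cube Q)) <= C%:E * wmeas w (cube Q) < +oo.

(* If w(Q) = 0 the left-hand side below is 0 / 0 = 0 * +oo = 0. *)
Definition Ainfty_class Omega (beta : R) w :=
  weight Omega w /\
  exists c delta : R, [/\ (0 < c)%R, (0 < delta)%R &
    forall Q E, cubes Omega beta Q ->
      measurable (E : set (leb_rV R n)) -> E `<=` cube Q ->
      wmeas w E / wmeas w (cube Q) <= c%:E * (mu E / mu (cube Q)) `^ delta].

(* Extended inverse: 0^-1 = +oo and +oo^-1 = 0. The power poweR with a negative
   exponent would wrongly send 0 to 0 and +oo to +oo. *)
Definition sigma_weight (p : R) v : V -> \bar R :=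
  fun x => (v x `^ (p - 1)^-1)^-1.

Definition Apq_class Omega (beta p q : R) u v :=
  exists C : R, forall Q, cubes Omega beta Q ->
    wmeas u (cube Q) `^ (p / q) / mu (cube Q) *
    (wmeas (sigma_weight p v) (cube Q) / mu (cube Q)) `^ (p - 1) <= C%:E.

Definition maximal_op Omega (beta : R) (f : V -> R) (x : V) : \bar R :=
  ereal_sup [set (mu (cube Q))^-1 * \int[mu]_(y in cube Q) `|f y|%:E |
             Q in [set Q | cubes Omega beta Q /\ cube Q x]].

Definition Lp_weight Omega (p : R) w : set (V -> R) :=
  [set f : V -> R | measurable_fun (Omega : set (leb_rV R n)) f /\
                 \int[mu]_(x in Omega) ((`|f x| `^ p)%:E * w x) < +oo].

Definition bounded_op Omega (p q : R) v u (T : (V -> R) -> V -> \bar R) :=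
  exists C : R, forall f, Lp_weight Omega p v f ->
    (\int[mu]_(x in Omega) (`|T f x| `^ q * u x)) `^ q^-1 <=
    C%:E * (\int[mu]_(x in Omega) ((`|f x| `^ p)%:E * v x)) `^ p^-1.

End weights.

(* Main.v *)
Require Import Defs.
From mathcomp Require Import all_boot all_order all_algebra.
From mathcomp Require Import all_classical all_reals all_analysis.
From mathcomp Require Import measurable_realfun.
From mathcomp Require Import ring lra.

(* Necessity: test the maximal operator on sigma restricted to a cube.

   Sufficiency: by A_infty, on a fixed proportion of a cube Q the weight sigma
   is at least a third of its average sigma(Q)/|Q|. Since the average of |f|
   over Q is sigma(Q)/|Q| times the sigma-average of f/sigma, this gives
     M f <= C (M (h^(1/2)))^2 on Omega,
     where h = M_sigma(f/sigma) sigma.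
   Hence only the boundedness of M from L^2p(v) to L^2q(u) is needed, and this
   follows by interpolation between the weak type (p, q), which is what A_{p,q}
   provides, and the trivial bound on L^oo. The same interpolation, between weak
   type (1, 1) and L^oo, bounds M_sigma on L^p(sigma), so that
     \int h^p v = \int M_sigma(f/sigma)^p sigma <= C \int |f|^p v.
   The weak type estimates use finite Vitali coverings. These require the
   weights to be doubling up to the boundary of the family of local cubes: a
   cube of the family which is large with respect to its distance to the
   complement is compared with its neighbours through chains of smaller cubes. *)

Set Implicit Arguments.
Unset Strict Implicit.
Unset Printing Implicit Defensive.

Import Order.TTheory GRing.Theory Num.Theory.
Import numFieldNormedType.Exports.

Local Open Scope classical_set_scope.
Local Open Scope ring_scope.

(** * Lebesgue measure on row vectors *)

(** Interpolation between the weak type (p, q) and L^oo only reaches exponents [(p S, q S)] with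
    [S > 1], never [(p, q)] itself. The usual remedy is to improve the weight condition to a smaller
    exponent by a reverse Hoelder inequality. The square root replaces it: the estimate for [M] at
    [(2 p, 2 q)] is applied to [h^(1/2)], and squaring brings the exponents back to [(p, q)]. Any
    [S > 1] with [h^(1/S)] would serve. The passage through [h] is affordable because
    [sigma^p v = sigma], so that the [v]-norm of [h] is a sigma-norm of the weighted maximal
    function, which is bounded by doubling alone. A root, however, flattens peaks: the average of
    [h^(1/2)] has a lower bound only if [h] is large on a fixed proportion of the cube, and this is
    why A_infty enters. The condition [p <= q] is used through the superadditivity of [t^(q/p)],
    which turns a sum over disjoint cubes into one integral. Doubling of [u] serves the weak type of
    [M], doubling of sigma that of M_sigma. *)

Section cubes_in_space.
Context {R : realType} {n : nat}.
Local Notation V := 'rV[R]_n.+1.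

Lemma cubeP (Q : V * R) (x : V) :
  cube Q x <-> forall i, `|Q.1 ord0 i - x ord0 i| < Q.2.
Proof.
rewrite /cube; split=> [[_ h] i|h]; first exact: (h ord0 i).
split; last by move=> i j; rewrite (ord1 i); exact: h.
by rewrite (le_lt_trans _ (h ord0)).
Qed.

Lemma cube_normP (Q : V * R) (x : V) : cube Q x <-> `|Q.1 - x| < Q.2.
Proof. by rewrite /cube mx_norm_ball. Qed.

(** Rational cubes are countable, and each one that lies in a member of [G] selects such a member;
    the others select [Q0], which adds nothing outside the union. This makes the level sets of
    maximal functions, a priori uncountable unions, countable ones. *)
Lemma cube_lindelof (G : set (V * R)) : G !=set0 ->
  exists2 Q : nat -> V * R, (forall k, G (Q k)) &
    \bigcup_(q in G) cube q = \bigcup_k cube (Q k).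
Proof.
move=> [Q0 GQ0].
pose rcube (a : 'rV[rat]_n.+1 * rat) : set V :=
  cube (map_mx ratr a.1 : V, ratr a.2).
have /choice[pickQ pickQP] : forall a, exists q, G q /\
    ((exists2 q', G q' & rcube a `<=` cube q') -> rcube a `<=` cube q).
  move=> a; have [[q Gq aq]|nq] := pselect (exists2 q, G q & rcube a `<=` cube q).
    by exists q.
  by exists Q0.
exists (fun k => if unpickle k is Some a then pickQ a else Q0).
  by move=> k; case: unpickle => // a; exact: (pickQP a).1.
apply/seteqP; split=> [x [q Gq qx]|x [k _]]; last first.
  case: unpickle => [a ax|Q0x]; last by exists Q0.
  by exists (pickQ a) => //; exact: (pickQP a).1.
pose e := q.2 - `|q.1 - x|.
have e0 : 0 < e by rewrite subr_gt0; exact/cube_normP.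
(* Half of the margin [e], because a point of the rational cube may be almost [2 r] away from
   [x]. *)
have [r re] : exists r : rat, 0 < (ratr r : R) < e / 2.
  have e20 : 0 < e / 2 by lra.
  by have [r] := rat_in_itvoo e20; rewrite in_itv; exists r.
have r0 : 0 < (ratr r : R) by case/andP: re.
have /choice[c cP] : forall i, exists c : rat, `|ratr c - x ord0 i| < (ratr r : R).
  move=> i; have xr : x ord0 i - ratr r < x ord0 i + ratr r by lra.
  have [c] := rat_in_itvoo xr; rewrite in_itv /= => cx; exists c.
  by rewrite ltr_distl.
pose a := (\row_i c i, r).
have ax : rcube a x by apply/cubeP => i /=; rewrite !mxE; exact: cP.
have aq : rcube a `<=` cube q.
  move=> y /cube_normP /= cy; apply/cube_normP.
  move: ax => /cube_normP /= cx.
  rewrite (le_lt_trans (ler_distD x _ _))//.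
  rewrite (le_lt_trans (lerD (lexx _) (ler_distD (map_mx ratr (\row_i c i)) _ _)))//.
  rewrite (distrC x) -ltrBrDl -/e.
  by case/andP: re; lra.
exists (pickle a) => //; rewrite pickleK.
by apply: (pickQP a).2 => //; exists q.
Qed.

End cubes_in_space.

(** * Measurability of cubes and open sets *)

Section lebesgue_rV_measurable.
Context {R : realType} {n : nat}.
Local Notation V := 'rV[R]_n.+1.
Local Notation L := (leb_rV R n).
Local Notation mu := (@lebesgue_rV R n).

Let set_coord (x : V) (i : 'I_n.+1) (c : R) : V :=
  \row_j (if j == i then c else x ord0 j).

Let cut_le (i : 'I_n.+1) c (ab : V * V) : V * V :=
  (ab.1, set_coord ab.2 i (Num.min (ab.2 ord0 i) c)).

Let cut_gt (i : 'I_n.+1) c (ab : V * V) : V * V :=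
  (set_coord ab.1 i (Num.max (ab.1 ord0 i) c), ab.2).

Let box_cut_le i c ab : box ab `&` [set x | x ord0 i <= c] `<=` box (cut_le i c ab).
Proof.
move=> x [abx /= xc] j /=; rewrite mxE; have := abx j.
by case: eqP => [->|//]; rewrite le_min xc andbT.
Qed.

Let box_cut_gt i c ab : box ab `&` [set x | c < x ord0 i] `<=` box (cut_gt i c ab).
Proof.
move=> x [abx /= xc] j /=; rewrite mxE; have := abx j.
by case: eqP => [->|//]; rewrite gt_max xc andbT.
Qed.

Let box_vol_cut i c (ab : V * V) :
  box_vol (cut_le i c ab) + box_vol (cut_gt i c ab) <= box_vol ab.
Proof.
have volE (ab' : V * V) : box_vol ab' = Num.max 0 (ab'.2 ord0 i - ab'.1 ord0 i) *
    \prod_(j < n.+1 | j != i) Num.max 0 (ab'.2 ord0 j - ab'.1 ord0 j).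
  by rewrite /box_vol (bigD1 i).
rewrite !volE /= !mxE eqxx.
set P := (X in _ * X + _ <= _); set P' := (X in _ + _ * X <= _).
have -> : P = \prod_(j < n.+1 | j != i) Num.max 0 (ab.2 ord0 j - ab.1 ord0 j).
  by apply: eq_bigr => j /negbTE ji; rewrite !mxE ji.
have -> : P' = \prod_(j < n.+1 | j != i) Num.max 0 (ab.2 ord0 j - ab.1 ord0 j).
  by apply: eq_bigr => j /negbTE ji; rewrite !mxE ji.
rewrite -mulrDl ler_wpM2r//; first by apply: prodr_ge0 => j _; rewrite le_max lexx.
move: (ab.1 ord0 i) (ab.2 ord0 i) => a b.
rewrite /Num.min /Num.max.
by repeat case: ifPn; lra.
Qed.

(** Caratheodory's criterion, checked cover by cover: the hyperplane cuts each half-open box into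
    two half-open boxes, and this does not increase the total volume. *)
Lemma measurable_coord_le (i : 'I_n.+1) (c : R) :
  measurable ([set x : V | x ord0 i <= c] : set L).
Proof.
apply: le_caratheodory_measurable => X.
apply: le_ereal_inf_tmp => _ [B XB <-].
apply: (@le_trans _ _ (\sum_(k <oo) (box_vol (cut_le i c (B k)))%:E +
                       \sum_(k <oo) (box_vol (cut_gt i c (B k)))%:E)%E).
  apply: leeD; apply: ereal_inf_lbound.
    exists (fun k => cut_le i c (B k)) => // x [/XB[k _ Bx] xc].
    by exists k => //; apply: box_cut_le.
  exists (fun k => cut_gt i c (B k)) => // x [/XB[k _ Bx] /= xc].
  by exists k => //; apply: box_cut_gt; split=> //=; rewrite ltNge; exact/negP.
rewrite -nneseriesD; try by move=> *; exact: box_vol_ge0.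
apply: lee_nneseries => [k _ _|k _]; first by rewrite adde_ge0// box_vol_ge0.
by rewrite -EFinD lee_fin box_vol_cut.
Qed.

Lemma measurable_cube (Q : V * R) : measurable (cube Q : set L).
Proof.
have -> : cube Q = \bigcap_(i in [set: 'I_n.+1])
    (\bigcup_k [set x : V | x ord0 i <= Q.1 ord0 i + Q.2 - k.+1%:R^-1] `&`
     ~` [set x : V | x ord0 i <= Q.1 ord0 i - Q.2]).
  apply/seteqP; split=> [x /cubeP Qx i _|x Qx].
    have := Qx i; rewrite distrC ltr_distl => /andP[xl xr]; split.
      exists (Num.truncn ((Q.1 ord0 i + Q.2 - x ord0 i)^-1)) => //=.
      rewrite lerBrDr -lerBrDl invf_ple ?posrE ?subr_gt0//.
      by rewrite ltW// truncnS_gt.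
    by apply/negP; rewrite -ltNge.
  apply/cubeP => i; rewrite distrC ltr_distl.
  have [[k _ /= xk] /= /negP] := Qx i I; rewrite -ltNge => -> /=.
  by rewrite (le_lt_trans xk)// ltrBlDr ltrDl invr_gt0.
apply: fin_bigcap_measurable; first exact: finite_finset.
move=> i _; apply: measurableI; last by apply: measurableC; exact: measurable_coord_le.
by apply: bigcup_measurable => k _; exact: measurable_coord_le.
Qed.

Lemma measurable_bigcup_cube (G : set (V * R)) :
  measurable (\bigcup_(q in G) cube q : set L).
Proof.
have [->|/set0P G0] := eqVneq G set0; first by rewrite bigcup_set0; exact: measurable0.
have [Q _ ->] := cube_lindelof G0.
by apply: bigcup_measurable => k _; exact: measurable_cube.
Qed.

Lemma measurable_open_rV (U : set V) : open U -> measurable (U : set L).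
Proof.
move=> oU; have -> : U = \bigcup_(q in [set q | cube q `<=` U]) cube q.
  apply/seteqP; split=> [x Ux|x [q qU qx]]; last exact: qU.
  move: oU; rewrite openE => /(_ _ Ux) /nbhs_ballP[e /= e0 xU].
  by exists (x, e) => //; exact: ballxx.
exact: measurable_bigcup_cube.
Qed.

End lebesgue_rV_measurable.

(** * Cubes have positive finite measure *)

Section lebesgue_rV_cube.
Context {R : realType} {n : nat}.
Local Notation V := 'rV[R]_n.+1.
Local Notation L := (leb_rV R n).
Local Notation mu := (@lebesgue_rV R n).

(* The indicator function of a box, the first [j] coordinates being integrated
   out. *)
Let partial_vol (j : nat) (ab : V * V) (x : 'I_n.+1 -> R) (i : 'I_n.+1) : R :=
  if (i < j)%N then Num.max 0 (ab.2 ord0 i - ab.1 ord0 i)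
  else \1_(`]ab.1 ord0 i, ab.2 ord0 i]%classic : set R) (x i).

Let partial_vol_ge0 j ab x i : 0 <= partial_vol j ab x i.
Proof. by rewrite /partial_vol; case: ifP => _; rewrite ?le_max ?lexx// indicE. Qed.

Let integral_partial_vol (j : 'I_n.+1) ab x :
  (\int[lebesgue_measure]_t
     (\prod_i partial_vol j ab (fun i => if i == j then t else x i) i)%:E =
   (\prod_i partial_vol j.+1 ab x i)%:E)%E.
Proof.
rewrite (bigD1 j)//=.
have -> : partial_vol j.+1 ab x j = Num.max 0 (ab.2 ord0 j - ab.1 ord0 j).
  by rewrite /partial_vol ltnSn.
set P := \prod_(i < _ | _) _.
under eq_integral => t _.
  rewrite (bigD1 j)//= {1}/partial_vol ltnn eqxx.
  rewrite (_ : \prod_(i < _ | _) _ = P); last first.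
    apply: eq_bigr => i ij; rewrite /partial_vol (negbTE ij).
    by rewrite ltnS [(i <= j)%N]leq_eqVlt -[(i == j :> nat)]/(i == j) (negbTE ij).
  rewrite mulrC EFinM; over.
rewrite ge0_integralZl//=.
- rewrite integral_indic// setIT mulrC EFinM; congr *%E.
  rewrite [LHS](lebesgue_measure_itv `]ab.1 ord0 j, ab.2 ord0 j])/=.
  rewrite lte_fin; case: ltP => h.
    by rewrite -EFinB max_r// subr_ge0 ltW.
  by rewrite max_l// subr_le0.
- by apply/measurable_EFinP.
- by rewrite lee_fin; apply: prodr_ge0 => i _; exact: partial_vol_ge0.
Qed.

(** At [j = 0] this bounds the indicator of a box by the sum of the indicators of a cover. Each
    further [j] integrates one more coordinate against the one-dimensional Lebesgue measure,
    monotone convergence moving the integral inside the series. At [j = n.+1] only volumes remain,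
    so countable subadditivity of the volume follows without a compactness argument. *)
Let partial_vol_cover (ab : V * V) (B : nat -> V * V) :
  box ab `<=` \bigcup_k box (B k) -> forall j, (j <= n.+1)%N -> forall x,
  ((\prod_i partial_vol j ab x i)%:E <=
   \sum_(k <oo) (\prod_i partial_vol j (B k) x i)%:E)%E.
Proof.
move=> abB; elim=> [_ x|j IH jn x].
  have ge0 k : (0 <= (\prod_i partial_vol 0 (B k) x i)%:E)%E.
    by rewrite lee_fin; apply: prodr_ge0 => i _; exact: partial_vol_ge0.
  have one ab' : box ab' (\row_i x i) -> \prod_i partial_vol 0 ab' x i = 1.
    move=> ab'x; apply: big1 => i _; rewrite /partial_vol /= indicE.
    by have := ab'x i; rewrite mxE => ?; rewrite mem_set//= in_itv.
  have [abx|nabx] := pselect (box ab (\row_i x i)).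
    have [k _ Bx] := abB _ abx.
    rewrite (one _ abx) (@nneseriesD1 _ _ k)//= (one _ Bx) leeDl//.
    by apply: nneseries_ge0 => i _ _; exact: ge0.
  suff -> : \prod_i partial_vol 0 ab x i = 0.
    by apply: (@nneseries_ge0 _ _ xpredT) => k _ _; exact: ge0.
  move/existsNP : nabx => [i]; rewrite mxE => abi.
  rewrite (bigD1 i)//= {1}/partial_vol /= indicE memNset ?mul0r//=.
have jn' := ltnW jn.
have := integral_partial_vol (Ordinal jn) ab x; rewrite /= => <-.
rewrite (eq_eseriesr (fun k _ => esym (integral_partial_vol (Ordinal jn) (B k) x))).
have mP ab' : measurable_fun [set: measurableTypeR R] (fun t => (\prod_i
    partial_vol (Ordinal jn) ab' (fun i => if i == Ordinal jn then t else x i) i)%:E).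
  apply/measurable_EFinP; apply: measurable_prod => i _ /=.
  rewrite /partial_vol; case: (i < _)%N; first exact: measurable_cst.
  by case: (i == _); [exact: measurable_indic|exact: measurable_cst].
rewrite -integral_nneseries//.
- apply: ge0_le_integral => //.
  + by move=> t _; rewrite lee_fin; apply: prodr_ge0 => i _; exact: partial_vol_ge0.
  + by apply: ge0_emeasurable_sum => // k t _ _;
      rewrite lee_fin; apply: prodr_ge0 => i _; exact: partial_vol_ge0.
  + by move=> t _; exact: IH.
- by move=> k t _; rewrite lee_fin; apply: prodr_ge0 => i _; exact: partial_vol_ge0.
Qed.

Lemma lebesgue_rV_box_ge (ab : V * V) : ((box_vol ab)%:E <= lebesgue_outer (box ab))%E.
Proof.
apply: le_ereal_inf_tmp => _ [B abB <-].
have volE (ab' : V * V) : \prod_i partial_vol n.+1 ab' (fun=> 0) i = box_vol ab'.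
  by apply: eq_bigr => i _; rewrite /partial_vol ltn_ord.
rewrite -volE; under eq_eseriesr do rewrite -volE.
exact: partial_vol_cover.
Qed.

Lemma lebesgue_rV_cube_gt0 (Q : V * R) : 0 < Q.2 -> (0 < mu (cube Q))%E.
Proof.
move=> Q0; pose h : V := const_mx (Q.2 / 2).
apply: (@lt_le_trans _ _ (box_vol (Q.1 - h, Q.1 + h))%:E).
  rewrite lte_fin; apply: prodr_gt0 => i _; rewrite !mxE /=.
  by rewrite lt_max; apply/orP; right; lra.
apply: (le_trans (lebesgue_rV_box_ge _)).
apply: le_outer_measure => x hx; apply/cubeP => i.
by have := hx i; rewrite !mxE /= => /andP[? ?]; rewrite ltr_norml; lra.
Qed.

Lemma lebesgue_rV_cube_lty (Q : V * R) : (mu (cube Q) < +oo)%E.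
Proof.
pose h : V := const_mx Q.2.
apply: (@le_lt_trans _ _ (box_vol (Q.1 - h, Q.1 + h))%:E); last exact: ltry.
pose B (k : nat) : V * V := if k == 0%N then (Q.1 - h, Q.1 + h) else (0, 0).
apply: ereal_inf_lbound; exists B.
  move=> x /cubeP Qx; exists 0%N => //= i.
  by have := Qx i; rewrite !mxE ltr_norml => /andP[? ?]; apply/andP; split; lra.
rewrite (@nneseriesD1 _ _ 0%N)//=; last by move=> k _; exact: box_vol_ge0.
rewrite eseries0 ?adde0// => -[//|k] _ _ /=.
by rewrite /box_vol big_ord_recl /= subrr maxxx mul0r.
Qed.

End lebesgue_rV_cube.

(** * Covering and weak type estimates in a measure space *)

Section poweR_superadditive.
Context {R : realType}.
Local Open Scope ereal_scope.

(** Write [z^r = z z^(r-1)]: the second factor is nondecreasing in [z]. The case of interest is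
    [r = q / p]. *)
Lemma poweRD_le (x y : \bar R) (r : R) : 0 <= x -> 0 <= y -> (1 <= r)%R ->
  x `^ r + y `^ r <= (x + y) `^ r.
Proof.
move=> x0 y0 r1; have r0 : (r != 0)%R by rewrite gt_eqF// (lt_le_trans _ r1).
case: x x0 => [x| |] // x0; last first.
  by rewrite [in leRHS]addye ?poweRyr ?leey// -ltNye (lt_le_trans _ y0).
case: y y0 => [y| |] // y0; last by rewrite [in leRHS]addey ?poweRyr ?leey.
rewrite -[in leRHS]EFinD !poweR_EFin -EFinD lee_fin; rewrite !lee_fin in x0 y0.
have r10 : (0 <= r - 1)%R by rewrite subr_ge0.
have powS (z : R) : (0 <= z -> z `^ r = z * z `^ (r - 1))%R.
  move=> z0; have [->|zn0] := eqVneq z 0%R; first by rewrite mul0r powR0.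
  by rewrite -{2}(powRr1 z0) -powRD ?subrKC// zn0 implybT.
rewrite [leRHS]powS ?addr_ge0// mulrDl lerD//.
  by rewrite powS// ler_wpM2l// ge0_ler_powR ?nnegrE ?lerDl// addr_ge0.
by rewrite powS// ler_wpM2l// ge0_ler_powR ?nnegrE ?lerDr// addr_ge0.
Qed.

Lemma sume_poweR_le (I : Type) (s : seq I) (f : I -> \bar R) (r : R) :
  (forall i, 0 <= f i) -> (1 <= r)%R ->
  \sum_(i <- s) f i `^ r <= (\sum_(i <- s) f i) `^ r.
Proof.
move=> f0 r1; elim: s => [|i s IH].
  by rewrite !big_nil poweR0r// gt_eqF// (lt_le_trans _ r1).
rewrite !big_cons (le_trans (leeD (lexx _) IH))// poweRD_le//.
exact: sume_ge0.
Qed.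

Lemma lee_poweR (x y : \bar R) (r : R) : (0 <= r)%R -> 0 <= x -> x <= y ->
  x `^ r <= y `^ r.
Proof.
move=> r0 x0 xy; apply: gt0_ler_poweR => //; rewrite in_itv/= leey andbT//.
exact: le_trans xy.
Qed.

End poweR_superadditive.

(** * Vitali selection in a finite family *)

Section vitali_finite.
Context {R : realType} {T : Type} {I : eqType}.
Variables (B : I -> set T) (l : I -> R).

(** Greedy selection: a member of largest size is kept and dominates all those that meet it; the
    remaining ones are disjoint from it and are treated by induction. No dilation is mentioned, so
    the lemma applies to abstract sets, and its conclusion is the situation that [engulfing]
    describes. *)
Lemma vitali_finite (s : seq I) : (forall i, i \in s -> B i !=set0) ->
  exists D : seq I, [/\ uniq D, {subset D <= s}, trivIset [set` D] B &
    forall i, i \in s -> exists j, [/\ j \in D, B i `&` B j !=set0 & l i <= l j]].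
Proof.
have [m] := ubnP (size s); elim: m s => // m IH [_ _|i s]; first by exists nil.
rewrite ltnS => sm Bs.
have [i0 i0s i0max] : exists2 i0, i0 \in i :: s &
    forall j, j \in i :: s -> l j <= l i0.
  have : exists2 i0, i0 \in i :: s & all (fun j => l j <= l i0) (i :: s).
    clear; elim: s i => [|k s IH] i.
      by exists i; rewrite ?mem_head//= lexx.
    have [i0 i0s i0all] := IH k; have [ii0|/ltW i0i] := leP (l i) (l i0).
      exists i0; first by rewrite in_cons i0s orbT.
      by apply/andP; split; [exact: ii0|exact: i0all].
    exists i; first exact: mem_head.
    apply/andP; split; first exact: lexx.
    apply: sub_all i0all => j ji0; exact: le_trans ji0 i0i.
  by case=> i0 ? /allP; exists i0.
pose s' := [seq j <- i :: s | `[< B j `&` B i0 = set0 >]].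
have [||D [uD Ds tD HD]] := IH s'.
(* The list gets shorter because the nonempty set [B i0] meets itself. *)
- rewrite (leq_trans _ sm)// size_filter -[ltnRHS](count_predT (i :: s)).
  have -> : count predT (i :: s) = (count (fun j => `[< B j `&` B i0 = set0 >]) (i :: s) +
      count (predC (fun j => `[< B j `&` B i0 = set0 >])) (i :: s))%N.
    by rewrite count_predC count_predT.
  rewrite -[ltnLHS]addn0 ltn_add2l -has_count; apply/hasP; exists i0 => //=.
  by apply/asboolPn/eqP; rewrite setIid; exact/set0P/Bs.
- by move=> j; rewrite mem_filter => /andP[_]; exact: Bs.
exists (i0 :: D); split=> /=.
- rewrite uD andbT; apply/negP => /Ds; rewrite mem_filter => /andP[/asboolP].
  by rewrite setIid => /eqP; have /set0P/negbTE -> := Bs _ i0s.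
- by move=> j; rewrite inE => /predU1P[->//|/Ds]; rewrite mem_filter => /andP[].
- have disj j : j \in D -> B j `&` B i0 = set0.
    by move=> /Ds; rewrite mem_filter => /andP[/asboolP].
  move=> j k /=; rewrite !inE => /predU1P[->|jD] /predU1P[->|kD] //.
  + by rewrite setIC disj// => -[].
  + by rewrite disj// => -[].
  + exact: tD.
- move=> j js; have [jj|/eqP/set0P jj] := pselect (B j `&` B i0 = set0).
    have [|k [kD jk ljk]] := HD j; first by rewrite mem_filter js andbT; exact/asboolP.
    by exists k; rewrite inE kD orbT.
  by exists i0; rewrite mem_head; split => //; exact: i0max.
Qed.

End vitali_finite.

(** * Integrals of a nonnegative function as set functions *)

Section ge0_integral_extra.
Context d (T : measurableType d) (R : realType) (mu : {measure set T -> \bar R}).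
Variable w : T -> \bar R.
Hypotheses (mw : measurable_fun setT w) (w0 : forall x, (0 <= w x)%E).
Local Open Scope ereal_scope.

Lemma ge0_le_integral_set (A A' : set T) : measurable A -> measurable A' ->
  A `<=` A' -> \int[mu]_(x in A) w x <= \int[mu]_(x in A') w x.
Proof.
move=> mA mA' AA'; apply: ge0_subset_integral => //.
exact: measurable_funS mw.
Qed.

Lemma ge0_integral_setU_le (A A' : set T) : measurable A -> measurable A' ->
  \int[mu]_(x in A `|` A') w x <= \int[mu]_(x in A) w x + \int[mu]_(x in A') w x.
Proof.
move=> mA mA'; have -> : A `|` A' = A `|` (A' `\` A) by rewrite setUDr setDv setD0.
have mD := measurableD mA' mA.
rewrite ge0_integral_setU//; last 2 first.
- exact: measurable_funS mw.
- by apply/disj_setPS => x [Ax [_]].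
by rewrite leeD2l// ge0_le_integral_set.
Qed.

Lemma ge0_integral_bigsetU_le (I : Type) (s : seq I) (A : I -> set T) :
  (forall i, measurable (A i)) ->
  \int[mu]_(x in \big[setU/set0]_(i <- s) A i) w x <=
  \sum_(i <- s) \int[mu]_(x in A i) w x.
Proof.
move=> mA; elim: s => [|i s IH]; first by rewrite !big_nil integral_set0.
rewrite !big_cons (le_trans (ge0_integral_setU_le _ _))//.
  exact: bigsetU_measurable.
exact: leeD.
Qed.

Lemma ge0_integral_bigcup_le (A : (set T)^nat) (M : \bar R) :
  (forall k, measurable (A k)) -> nondecreasing_seq A ->
  (forall k, \int[mu]_(x in A k) w x <= M) ->
  \int[mu]_(x in \bigcup_k A k) w x <= M.
Proof.
move=> mA ndA AM.
have cvgA : \int[mu]_(x in A k) w x @[k --> \oo] --> \int[mu]_(x in \bigcup_k A k) w x.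
  apply: ge0_nondecreasing_set_cvg_integral => //.
  by move=> k; exact: measurable_funS mw.
rewrite -(cvg_lim _ cvgA)//; apply: lime_le; last by apply: nearW.
by apply/cvg_ex; eexists; exact: cvgA.
Qed.

End ge0_integral_extra.

(** * Weak type bounds from engulfing *)

Section weak_type.
Context d (T : measurableType d) (R : realType) (mu : {measure set T -> \bar R}).
Context (I : choiceType).
Variables (F : set I) (B : I -> set T) (l : I -> R).
Hypothesis mB : forall i, measurable (B i).
Hypothesis B_neq0 : forall i, F i -> B i !=set0.
Hypothesis B_lindelof : forall G : set I, G !=set0 ->
  exists2 Q : nat -> I, (forall k, G (Q k)) &
    \bigcup_(q in G) B q = \bigcup_k B (Q k).
Local Open Scope ereal_scope.

(** Doubling in the form that a Vitali covering consumes. The union of the neighbours is measured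
    itself rather than a dilate of [Q], since the dilate of a local cube may leave the family and
    even Omega. *)
Definition engulfing (w : T -> \bar R) (C : R) :=
  forall Q (s : seq I), F Q ->
    (forall q, q \in s -> [/\ F q, B q `&` B Q !=set0 & (l q <= l Q)%R]) ->
    \int[mu]_(x in \big[setU/set0]_(q <- s) B q) w x <=
    C%:E * \int[mu]_(x in B Q) w x.

(** Monotone convergence reduces the claim to finite subfamilies. There each selected set pays, by
    engulfing, for the neighbours it dominates; the selected sets are disjoint and [r >= 1], so
    their powers add up to at most the power of one integral. *)
Lemma weak_type_cover (w g : T -> \bar R) (C K r : R) (G : set I) :
  measurable_fun setT w -> (forall x, 0 <= w x) ->
  measurable_fun setT g -> (forall x, 0 <= g x) ->
  (0 <= C)%R -> (0 <= K)%R -> (1 <= r)%R -> engulfing w C -> G `<=` F ->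
  (forall Q, G Q -> \int[mu]_(x in B Q) w x <=
                    K%:E * (\int[mu]_(x in B Q) g x) `^ r) ->
  \int[mu]_(x in \bigcup_(Q in G) B Q) w x <= (C * K)%:E * (\int[mu]_x g x) `^ r.
Proof.
move=> mw w0 mg g0 C0 K0 r1 eng GF GK.
have r0 : (0 <= r)%R by rewrite (le_trans _ r1).
have [->|/set0P Gn0] := eqVneq G set0.
  by rewrite bigcup_set0 integral_set0 mule_ge0 ?poweR_ge0// lee_fin mulr_ge0.
have [Q GQ ->] := B_lindelof Gn0.
rewrite -bigcup_bigsetU_bigcup; apply: ge0_integral_bigcup_le => //.
- by move=> k; apply: bigsetU_measurable.
- move=> i j ij; apply/subsetPset.
  exact: (@subset_bigsetU _ (fun k => B (Q k)) i.+1 j.+1).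
move=> m; pose s := [seq Q k | k <- index_iota 0 m.+1].
have sG q : q \in s -> G q by move=> /mapP[k _ ->].
have [|D [uD Ds tD HD]] := @vitali_finite R T I B l s.
  by move=> i /sG /GF; exact: B_neq0.
pose near j := [seq i <- s | `[< B i `&` B j !=set0 >] && (l i <= l j)%R].
have DG j : j \in D -> G j by move=> /Ds/sG.
apply: (@le_trans _ _ (\int[mu]_(x in \big[setU/set0]_(j <- D)
    \big[setU/set0]_(i <- near j) B i) w x)).
  apply: ge0_le_integral_set => //.
  + exact: bigsetU_measurable.
  + by apply: bigsetU_measurable => j _; exact: bigsetU_measurable.
  rewrite -(big_mkord xpredT (fun k => B (Q k))) -bigcup_seq => x [k km Qkx].
  have [|j [jD ij lij]] := HD (Q k); first exact: map_f.
  rewrite -bigcup_seq; exists j => //; rewrite -bigcup_seq; exists (Q k) => //=.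
  by rewrite mem_filter lij andbT map_f// andbT; exact/asboolP.
apply: le_trans (ge0_integral_bigsetU_le _ mw w0 _ _) _.
  by move=> j; exact: bigsetU_measurable.
apply: (@le_trans _ _ (\sum_(j <- D) (C * K)%:E * (\int[mu]_(x in B j) g x) `^ r)).
  rewrite big_seq [leRHS]big_seq; apply: lee_sum => j jD.
  rewrite EFinM -muleA; apply: (@le_trans _ _ (C%:E * \int[mu]_(x in B j) w x)).
    apply: eng; first exact/GF/DG.
    by move=> q; rewrite mem_filter => /andP[/andP[/asboolP ? ?] /sG/GF].
  by rewrite lee_wpmul2l ?lee_fin// GK//; exact: DG.
rewrite -ge0_sume_distrr; last by move=> j _; exact: poweR_ge0.
rewrite lee_wpmul2l ?lee_fin ?mulr_ge0//.
apply: (le_trans (sume_poweR_le _ _ r1)); first by move=> j; exact: integral_ge0.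
apply: lee_poweR => //; first by apply: sume_ge0 => j _; exact: integral_ge0.
rewrite -ge0_integral_bigsetU//; last exact: measurable_funS mg.
by apply: ge0_le_integral_set => //; apply: bigsetU_measurable.
Qed.

End weak_type.

(** * Interpolation along dyadic levels *)

Section dyadic_sums.
Context {R : realType}.

Lemma powR2_gt1 (a : R) : 0 < a -> 1 < 2 `^ a.
Proof.
move=> a0; rewrite lt_neqAle eq_sym powR_eq1 !negb_or; apply/andP; split.
  by rewrite (gt_eqF a0) -leNgt ler0n !andbT; apply/eqP; lra.
by rewrite -[leLHS](powRr0 2) ler_powR// ?ltW//; lra.
Qed.

Local Open Scope ereal_scope.

(** The dyadic scale [2^(i - N)]; the shift by [N] makes small levels available to series indexed by
    [nat]. *)
Definition level (N i : nat) : R := (2 ^+ i / 2 ^+ N)%R.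

Lemma level_gt0 N i : (0 < level N i)%R.
Proof. by rewrite /level divr_gt0// exprn_gt0. Qed.

Lemma levelS N i : level N i.+1 = (2 * level N i)%R.
Proof. by rewrite /level exprS mulrA. Qed.

Lemma level_powS N i (a : R) : (level N i.+1 `^ a = 2 `^ a * level N i `^ a)%R.
Proof. by rewrite levelS powRM// ltW// level_gt0. Qed.

Lemma level_bracket N (y : R) : (level N 0 < y)%R ->
  exists i, (level N i < y <= level N i.+1)%R.
Proof.
move=> y0; have ex : exists m, (y <= level N m)%R.
  exists (Num.truncn (y * 2 ^+ N)).+1.
  rewrite /level ler_pdivlMr ?exprn_gt0//; apply/ltW.
  apply: (lt_le_trans (truncnS_gt _)).
  by rewrite -(natrX _ 2 _.+1) ler_nat ltnW// ltn_expl.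
case: (ex_minnP ex) => -[|m] ym minm.
  by move: (lt_le_trans y0 ym); rewrite ltxx.
exists m; rewrite ym andbT ltNge; apply/negP => /minm; by rewrite ltnn.
Qed.

Lemma sum_level_le N (a : R) m : (0 < a)%R ->
  (\sum_(0 <= i < m) level N i `^ a <= (2 `^ a - 1)^-1 * level N m `^ a)%R.
Proof.
move=> a0; have a2 : (0 < 2 `^ a - 1 :> R)%R.
  by rewrite subr_gt0 powR2_gt1.
elim: m => [|m IH].
  by rewrite big_geq// mulr_ge0 ?invr_ge0 ?powR_ge0// ltW.
rewrite big_nat_recr//= (le_trans (lerD IH (lexx _)))// level_powS.
rewrite -[X in (_ + X)%R]mul1r -mulrDl mulrA ler_wpM2r ?powR_ge0//.
by rewrite mulrC ler_pdivlMr// mulrDl mulVf ?gt_eqF//; lra.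
Qed.

(** The levels below [2 y] form a geometric progression, whose sum is comparable to its largest
    term. *)
Lemma nneseries_level_le N (a : R) (y : \bar R) : (0 < a)%R -> 0 <= y ->
  \sum_(i <oo) (if ((level N i / 2)%:E < y)%E then level N i `^ a else 0)%:E <=
  ((2 `^ a - 1)^-1 * 2 `^ a * 2 `^ a)%:E * y `^ a.
Proof.
move=> a0 y0; have a2 : (0 < 2 `^ a - 1 :> R)%R.
  by rewrite subr_gt0 powR2_gt1.
apply: lime_le.
  by apply: is_cvg_nneseries => i _ _; case: ifP => _; rewrite lee_fin ?powR_ge0.
apply: nearW; elim=> [|m IH].
  rewrite big_geq// mule_ge0 ?poweR_ge0// lee_fin.
  by rewrite !mulr_ge0 ?invr_ge0 ?powR_ge0// ltW.
have [my|my] := boolP ((level N m / 2)%:E < y); last first.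
  by rewrite big_nat_recr//= (negbTE my) adde0.
apply: (@le_trans _ _ (\sum_(0 <= i < m.+1) (level N i `^ a)%:E)).
  by apply: lee_sum => i _; case: ifP => _; rewrite lee_fin ?powR_ge0.
rewrite sumEFin; apply: (@le_trans _ _ ((2 `^ a - 1)^-1 * level N m.+1 `^ a)%:E).
  by rewrite lee_fin sum_level_le.
(* The next level is four times a number below [y]; this is the origin of the two factors [2^a]. *)
have -> : level N m.+1 = (2 * 2 * (level N m / 2))%R by rewrite levelS; lra.
have l0 : (0 <= level N m / 2)%R by rewrite divr_ge0// ltW// level_gt0.
move: (level N m / 2)%R my l0 => z zy z0.
rewrite !powRM ?mulr_ge0// !mulrA EFinM lee_wpmul2l//.
  by rewrite lee_fin !mulr_ge0 ?invr_ge0 ?powR_ge0// ltW.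
by rewrite -poweR_EFin lee_poweR ?lee_fin// ltW.
Qed.

End dyadic_sums.

Section nneseries_extra.
Context {R : realType}.
Local Open Scope ereal_scope.

Lemma nneseries_mulr (y : nat -> R) (z : \bar R) :
  (forall i, (0 <= y i)%R) -> 0 <= z ->
  \sum_(i <oo) ((y i)%:E * z) = (\sum_(i <oo) (y i)%:E) * z.
Proof.
move=> y0; case: z => [z| |] // z0.
  rewrite muleC -nneseriesZl; last by move=> i _; rewrite lee_fin.
  by apply: eq_eseriesr => i _; rewrite muleC.
have [/existsNP[k /eqP yk]|y00] := pselect (~ forall i, y i = 0%R); last first.
  move/contrapT : y00 => y00.
  rewrite eseries0 ?eseries0 ?mul0e// => i _ _; rewrite y00//.
  by rewrite mul0e.
have yk0 : (0 < y k)%R by rewrite lt_neqAle eq_sym yk y0.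
transitivity (+oo : \bar R).
  apply: (@nneseries_pinfty _ _ xpredT k) => //.
  - by move=> i _; rewrite mule_ge0 ?lee_fin.
  - by rewrite gt0_muley// lte_fin.
rewrite gt0_muley//.
apply: (@lt_le_trans _ _ (y k)%:E); first by rewrite lte_fin.
rewrite (@nneseriesD1 _ _ k)// ?leeDl//; last by move=> i _; rewrite lee_fin.
by apply: nneseries_ge0 => i _ _; rewrite lee_fin.
Qed.

Lemma nneseries_poweR_le (x : nat -> \bar R) (r : R) :
  (forall i, 0 <= x i) -> (1 <= r)%R ->
  \sum_(i <oo) (x i `^ r) <= (\sum_(i <oo) x i) `^ r.
Proof.
move=> x0 r1; apply: lime_le.
  by apply: is_cvg_nneseries => i _ _; exact: poweR_ge0.
apply: nearW => k; apply: (le_trans (sume_poweR_le _ x0 r1)).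
apply: lee_poweR; first by rewrite (le_trans _ r1).
  exact: sume_ge0.
exact: nneseries_lim_ge.
Qed.

End nneseries_extra.

(** * Marcinkiewicz interpolation for an abstract maximal function *)

Section strong_type.
Context d (T : measurableType d) (R : realType) (mu : {measure set T -> \bar R}).
Context (I : choiceType).
Variables (F : set I) (B : I -> set T) (l : I -> R).
Hypothesis mB : forall i, measurable (B i).
Hypothesis B_neq0 : forall i, F i -> B i !=set0.
Hypothesis B_lindelof : forall G : set I, G !=set0 ->
  exists2 Q : nat -> I, (forall k, G (Q k)) &
    \bigcup_(q in G) B q = \bigcup_k B (Q k).
Local Open Scope ereal_scope.

(** At a point covered by no member of the family this is [-oo], hence the restriction to the union
    of the family in the final estimate. *)
Definition sup_over (a : I -> \bar R) (x : T) : \bar R :=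
  ereal_sup [set a Q | Q in [set Q | F Q /\ B Q x]].

Lemma sup_over_level (a : I -> \bar R) t :
  [set x | t < sup_over a x] = \bigcup_(Q in [set Q | F Q /\ t < a Q]) B Q.
Proof.
apply/seteqP; split=> [x /= /ereal_sup_gt[_ [Q [FQ Qx] <-] taQ]|x [Q [FQ taQ] Qx]].
  by exists Q.
by rewrite /= (lt_le_trans taQ)//; apply: ereal_sup_ubound; exists Q.
Qed.

Lemma measurable_bigcup_lindelof (G : set I) : measurable (\bigcup_(Q in G) B Q).
Proof.
have [->|/set0P Gn0] := eqVneq G set0; first by rewrite bigcup_set0.
by have [Q _ ->] := B_lindelof Gn0; exact: bigcup_measurable.
Qed.

Lemma measurable_sup_over (a : I -> \bar R) : measurable_fun setT (sup_over a).
Proof.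
apply: (measurability _ (ErealGenOInfty.measurableE R)).
move=> /= _ [_ [t ->]] <-; apply: measurableI => //.
rewrite preimage_itvoy.
by rewrite sup_over_level; exact: measurable_bigcup_lindelof.
Qed.

Variables (m : I -> R) (rho : T -> \bar R).
Hypothesis m_gt0 : forall Q, F Q -> (0 < m Q)%R.
Hypothesis mrho : measurable_fun setT rho.
Hypothesis rho_ge0 : forall x, 0 <= rho x.
Hypothesis rhoE : forall Q, F Q -> \int[mu]_(x in B Q) rho x = (m Q)%:E.

(** The density [rho] is meant to be sigma for the weighted maximal function and 1 for the ordinary
    one. *)
Definition avg (f : T -> \bar R) (Q : I) : \bar R :=
  (m Q)^-1%:E * \int[mu]_(x in B Q) (f x * rho x).

Variables (w tau : T -> \bar R) (p r C K : R).
Hypotheses (mw : measurable_fun setT w) (w_ge0 : forall x, 0 <= w x).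
Hypotheses (mtau : measurable_fun setT tau) (tau_ge0 : forall x, 0 <= tau x).
Hypotheses (p_gt0 : (0 < p)%R) (r_ge1 : (1 <= r)%R).
Hypotheses (C_ge0 : (0 <= C)%R) (K_ge0 : (0 <= K)%R).
Hypothesis eng : engulfing mu F B l w C.
(** The weak type on a single cube, where all information on the weights other than engulfing is
    concentrated. For [rho = 1] it comes from A_{p,q}, for [rho = sigma] it is an identity. *)
Hypothesis testK : forall (f : T -> \bar R) Q,
  measurable_fun setT f -> (forall x, 0 <= f x) -> F Q ->
  \int[mu]_(x in B Q) w x * avg f Q `^ (p * r) <=
  K%:E * (\int[mu]_(x in B Q) (f x `^ p * tau x)) `^ r.

(** The endpoint L^oo: [f] is at most its part above [t] plus [t], and a constant is its own
    average. Thus an average above [2 t] forces the average of the part above [t] to exceed [t]. *)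
Lemma avg_truncate (f : T -> \bar R) (t : R) (Q : I) :
  measurable_fun setT f -> (forall x, 0 <= f x) -> (0 <= t)%R -> F Q ->
  avg f Q <= avg (f \_ [set x | t%:E < f x]) Q + t%:E.
Proof.
move=> mf f0 t0 FQ; set ft := f \_ _.
have mft : measurable_fun setT ft.
  have mU : measurable [set x | t%:E < f x].
    by rewrite -[X in measurable X]setTI; exact: emeasurable_fun_o_infty.
  by apply/(measurable_restrictT f mU); exact: measurable_funTS.
have ft0 x : 0 <= ft x by rewrite /ft patchE; case: ifP.
have m0 := m_gt0 FQ.
rewrite /avg lee_pdivrMl// muleDr ?fin_num_adde_defl// muleA -EFinM divff ?gt_eqF// mul1e.
rewrite -(rhoE FQ) -ge0_integralZr//; last first.
  exact: measurable_funTS.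
have mfr g : measurable_fun setT g -> measurable_fun (B Q) (fun x => g x * rho x).
  move=> mg; apply: emeasurable_funM; first exact: measurable_funS mg.
  exact: measurable_funS mrho.
rewrite -ge0_integralD//; first last.
- by apply: emeasurable_funM => //; exact: measurable_funS mrho.
- by move=> x _; rewrite mule_ge0.
- exact: mfr.
- by move=> x _; rewrite mule_ge0.
apply: ge0_le_integral => //.
- by move=> x _; rewrite mule_ge0.
- exact: (mfr f mf).
- apply: emeasurable_funD; first exact: (mfr ft mft).
  by apply: emeasurable_funM => //; exact: measurable_funTS.
move=> x _; rewrite [X in _ <= _ + X]muleC -ge0_muleDl ?lee_fin// lee_wpmul2r//.
rewrite /ft patchE; case: ifPn => [_|]; first by rewrite leeDl ?lee_fin.
by rewrite notin_setE /= add0e => /negP; rewrite -leNgt.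
Qed.

Lemma weak_type_level (f : T -> \bar R) (t : R) :
  measurable_fun setT f -> (forall x, 0 <= f x) -> (0 < t)%R ->
  \int[mu]_(x in [set x | (2 * t)%:E < sup_over (avg f) x]) w x <=
  (C * (K * (t `^ (p * r))^-1))%:E *
  (\int[mu]_(x in [set x | t%:E < f x]) (f x `^ p * tau x)) `^ r.
Proof.
move=> mf f0 t0; set U := [set x | t%:E < f x].
have mU : measurable U.
  by rewrite -[X in measurable X]setTI; exact: emeasurable_fun_o_infty.
have mfp : measurable_fun setT (fun x => f x `^ p * tau x).
  apply: emeasurable_funM => //.
  exact: (measurableT_comp (measurable_poweR p)).
have tpr : (0 < t `^ (p * r))%R by exact: powR_gt0.
rewrite sup_over_level [X in _ * X `^ r]integral_mkcond.
apply: (weak_type_cover mB B_neq0 B_lindelof _ _ _ _ _ _ _ eng) => //.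
- by apply/(measurable_restrictT _ mU); exact: measurable_funTS.
- by move=> x; rewrite patchE; case: ifP => // _; rewrite mule_ge0 ?poweR_ge0.
- by rewrite mulr_ge0// invr_ge0 ltW.
- by move=> Q [].
move=> Q [FQ tQ].
have mft : measurable_fun setT (f \_ U).
  by apply/(measurable_restrictT f mU); exact: measurable_funTS.
have ft0 x : 0 <= (f \_ U) x by rewrite patchE; case: ifP.
have := testK mft ft0 FQ.
rewrite (_ : (fun x => (f \_ U) x `^ p * tau x) = (fun x => f x `^ p * tau x) \_ U); last first.
  apply/funext => x; rewrite !patchE; case: ifP => // _.
  by rewrite poweR0r ?mul0e// gt_eqF.
set J := (\int[mu]_(x in B Q) _) `^ r => KJ.
rewrite EFinM (muleC K%:E) -muleA -lee_pdivrMl ?invr_gt0// invrK.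
apply: le_trans KJ; rewrite muleC lee_wpmul2l ?integral_ge0//.
rewrite -poweR_EFin lee_poweR ?lee_fin//.
- by rewrite mulr_ge0 ?(le_trans _ r_ge1)// ltW.
- exact: ltW.
rewrite -(@leeD2rE _ t%:E)// (le_trans _ (avg_truncate mf f0 (ltW t0) FQ))//.
by rewrite -EFinD; apply/ltW; move: tQ; rewrite mulr_natl mulr2n.
Qed.

(** Write [L i] for the dyadic levels. The layer [M > L i] receives the weight [L (i+1)^(p r S)] and
    is estimated by the weak type at height [L i / 2]. Since [p r S = a r + p r], it contributes a
    multiple of [(L_i^a A_i)^r], where [A_i] is the integral of [f^p tau] over [f > L i / 2].
    Summing [L_i^a] over the levels below [2 f] costs a multiple of [f^a], and [a + p = p S]. *)
Lemma strong_type_level (S : R) (N : nat) (f : T -> \bar R) (a := (p * (S - 1))%R) :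
  (1 < S)%R -> measurable_fun setT f -> (forall x, 0 <= f x) ->
  \int[mu]_(x in [set x | (level N 0)%:E < sup_over (avg f) x])
     (sup_over (avg f) x `^ (p * r * S) * w x) <=
  (2 `^ (p * r * S) * (C * K * (2^-1 `^ (p * r))^-1) *
   ((2 `^ a - 1)^-1 * 2 `^ a * 2 `^ a) `^ r)%:E *
  (\int[mu]_x (f x `^ (p * S) * tau x)) `^ r.
Proof.
move=> S1 mf f0; set M := sup_over _; pose L : nat -> R := level N.
have a0 : (0 < a)%R by rewrite mulr_gt0// subr_gt0.
have r0 : (0 < r)%R by rewrite (lt_le_trans _ r_ge1).
have e0 : (0 < p * r * S)%R by rewrite !mulr_gt0// (lt_trans _ S1).
have L0 i : (0 < L i)%R by exact: level_gt0.
have mM : measurable_fun setT M by exact: measurable_sup_over.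
have mU t : measurable [set x | t%:E < M x].
  by rewrite -[X in measurable X]setTI; exact: emeasurable_fun_o_infty.
pose c i := (L i.+1 `^ (p * r * S))%R.
have c0 i : (0 <= c i)%R by exact: powR_ge0.
pose h i x : R := if (L i)%:E < M x then c i else 0%R.
have h0 i x : (0 <= h i x)%R by rewrite /h; case: ifP.
have Mh x : (L 0)%:E < M x -> M x `^ (p * r * S) <= \sum_(i <oo) (h i x)%:E.
  move=> Mx.
  (* Stated for all real [y] up to [M x] in order to include [M x = +oo], where arbitrarily large
     [y] force the series to be infinite. *)
  have key (y : R) : (L 0 < y)%R -> y%:E <= M x ->
      (y `^ (p * r * S))%:E <= \sum_(i <oo) (h i x)%:E.
    move=> Ly yM; have [i /andP[Liy yLi]] := level_bracket Ly.
    rewrite (@nneseriesD1 _ _ i)//; last by move=> k _; rewrite lee_fin.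
    rewrite {1}/h (lt_le_trans _ yM) ?lte_fin//.
    apply: (@le_trans _ _ (c i)%:E).
      rewrite lee_fin ge0_ler_powR ?nnegrE ?(ltW e0) ?(ltW (L0 _))//.
      exact: ltW (lt_trans (L0 0%N) Ly).
    by rewrite leeDl//; apply: nneseries_ge0 => k _ _; rewrite lee_fin.
  have Mx0 : 0 < M x by rewrite (lt_trans _ Mx)// lte_fin.
  case E : (M x) => [y| |]; last 2 first.
  - rewrite poweRyr ?gt_eqF// leye_eq; apply/eqP/eq_infty => z.
    pose y := (Num.max (L 0 + 1) (`|z| `^ (p * r * S)^-1))%R.
    apply: le_trans (key y _ _); last 2 first.
    + by rewrite lt_max ltrDl ltr01.
    + by rewrite E leey.
    rewrite lee_fin (le_trans (ler_norm z))//.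
    rewrite -[leLHS](powRr1)// -[X in (`|z| `^ X)%R](mulVf (x := (p * r * S)%R)) ?gt_eqF//.
    rewrite [leLHS]powRrM ge0_ler_powR ?nnegrE ?powR_ge0 ?(ltW e0)//.
      by rewrite le_max addr_ge0// ltW.
    by rewrite le_max lexx orbT.
  - by move: Mx0; rewrite E.
  by rewrite poweR_EFin; apply: key; rewrite -?lte_fin -?E.
have mMe : measurable_fun setT (fun x => M x `^ (p * r * S)).
  exact: (measurableT_comp (measurable_poweR _)).
have mfp : measurable_fun setT (fun x => f x `^ p * tau x).
  apply: emeasurable_funM => //.
  exact: (measurableT_comp (measurable_poweR p)).
have mwU i : measurable_fun setT (w \_ [set x | (L i)%:E < M x]).
  by apply/(measurable_restrictT w (mU _)); exact: measurable_funTS.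
pose A i := \int[mu]_(x in [set x | (L i / 2)%:E < f x]) (f x `^ p * tau x).
have A0 i : 0 <= A i by apply: integral_ge0 => x _; rewrite mule_ge0 ?poweR_ge0.
have wU0 i x : 0 <= (w \_ [set x | (L i)%:E < M x]) x by rewrite patchE; case: ifP.
apply: (@le_trans _ _ (\sum_(i <oo) (c i)%:E * \int[mu]_(x in [set x | (L i)%:E < M x]) w x)).
  apply: (@le_trans _ _ (\int[mu]_x \sum_(i <oo)
      ((c i)%:E * (w \_ [set x | (L i)%:E < M x]) x))).
    rewrite integral_mkcond; apply: ge0_le_integral => //.
    - move=> x _; rewrite patchE; case: ifP => // _.
      by rewrite mule_ge0 ?poweR_ge0.
    - apply/(measurable_restrictT _ (mU _)); apply: measurable_funTS.
      exact: emeasurable_funM.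
    - apply: ge0_emeasurable_sum => [i x _ _|i _].
        by rewrite mule_ge0// lee_fin.
      exact: emeasurable_funM.
    move=> x _; rewrite patchE; case: ifPn => [|_]; last first.
      by apply: nneseries_ge0 => i _ _; rewrite mule_ge0// lee_fin.
    rewrite inE /= => Mx.
    rewrite (_ : (fun n => _) = (fun n => \sum_(0 <= i < n) ((h i x)%:E * w x))).
      by rewrite nneseries_mulr// lee_wpmul2r// Mh.
    apply/funext => n; apply: eq_bigr => i _; rewrite patchE /h.
    case: ifPn => [|xU]; first by rewrite inE /= => ->.
    rewrite [point](_ : _ = 0)// mule0 ifF ?mul0e//.
    by apply/negbTE/negP => MU; move: xU; rewrite notin_setE.
  rewrite integral_nneseries//; last 2 first.
  - by move=> i; exact: emeasurable_funM.
  - by move=> i x _; rewrite mule_ge0// lee_fin.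
  apply: lee_nneseries => [i _ _|i _].
    by apply: integral_ge0 => x _; rewrite mule_ge0// lee_fin.
  rewrite ge0_integralZl//; last by rewrite lee_fin.
  by rewrite -integral_mkcond.
set C2 := (2 `^ (p * r * S) * (C * K * (2^-1 `^ (p * r))^-1))%R.
have C20 : (0 <= C2)%R by rewrite !mulr_ge0 ?invr_ge0 ?powR_ge0.
set C3 := ((2 `^ a - 1)^-1 * 2 `^ a * 2 `^ a)%R.
have C30 : (0 <= C3)%R.
  by rewrite !mulr_ge0 ?powR_ge0// invr_ge0 subr_ge0 ltW// powR2_gt1.
pose X i := (L i `^ a)%:E * A i.
have X0 i : 0 <= X i by rewrite mule_ge0// lee_fin powR_ge0.
apply: (@le_trans _ _ (\sum_(i <oo) C2%:E * X i `^ r)).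
  apply: lee_nneseries => [i _ _|i _].
    by rewrite mule_ge0 ?lee_fin//; exact: integral_ge0.
  have Li2 : (0 < L i / 2)%R by rewrite divr_gt0.
  have := weak_type_level mf f0 Li2; rewrite -/M mulrC divfK// => H.
  apply: (le_trans (lee_wpmul2l _ H)); first by rewrite lee_fin.
  rewrite -/(A i) /X poweRM ?lee_fin ?powR_ge0// poweR_EFin !muleA -!EFinM.
  rewrite lee_wpmul2r ?poweR_ge0// lee_fin le_eqVlt; apply/orP; left; apply/eqP.
  rewrite /C2 /c level_powS powRM ?invr_ge0 ?(ltW (L0 _))// -powRrM.
  have -> : (p * r * S = a * r + p * r)%R by rewrite /a; ring.
  have Lr : (L i `^ (a * r + p * r) = L i `^ (a * r) * L i `^ (p * r))%R.
    by rewrite powRD// (gt_eqF (L0 i)) implybT.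
  have Lpr : (L i `^ (p * r) != 0)%R by rewrite gt_eqF// powR_gt0.
  have hpr : (2^-1 `^ (p * r) != 0 :> R)%R by rewrite gt_eqF// powR_gt0// invr_gt0.
  by rewrite -/(L i) Lr; field; rewrite Lpr hpr.
rewrite nneseriesZl; last by move=> i _; exact: poweR_ge0.
rewrite [in leRHS]EFinM -muleA lee_wpmul2l ?lee_fin//.
(* With the power [r] outside the series, the layers can be recombined under a single integral. *)
apply: (le_trans (nneseries_poweR_le X0 r_ge1)).
rewrite -poweR_EFin -poweRM ?lee_fin//; last first.
  by apply: integral_ge0 => x _; rewrite mule_ge0 ?poweR_ge0.
apply: lee_poweR; first exact: ltW.
  by apply: nneseries_ge0 => i _ _; exact: X0.
have mV i : measurable [set x | (L i / 2)%:E < f x].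
  by rewrite -[X in measurable X]setTI; exact: emeasurable_fun_o_infty.
pose g i := (fun x => f x `^ p * tau x) \_ [set x | (L i / 2)%:E < f x].
have mg i : measurable_fun setT (g i).
  by apply/(measurable_restrictT _ (mV i)); exact: measurable_funTS.
have g0 i x : 0 <= g i x.
  by rewrite /g patchE; case: ifP => // _; rewrite mule_ge0 ?poweR_ge0.
have XE i : X i = \int[mu]_x ((L i `^ a)%:E * g i x).
  rewrite ge0_integralZl//; last by rewrite lee_fin powR_ge0.
  by rewrite /g -integral_mkcond.
rewrite (eq_eseriesr (fun i _ => XE i)) -integral_nneseries//; last 2 first.
- by move=> i; exact: emeasurable_funM.
- by move=> i x _; rewrite mule_ge0// lee_fin powR_ge0.
have mfpS : measurable_fun setT (fun x => f x `^ (p * S) * tau x).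
  apply: emeasurable_funM => //.
  exact: (measurableT_comp (measurable_poweR _)).
have fpS0 x : 0 <= f x `^ (p * S) * tau x by rewrite mule_ge0// poweR_ge0.
rewrite -ge0_integralZl ?lee_fin//; apply: ge0_le_integral => //.
- move=> x _; apply: nneseries_ge0 => i _ _.
  by rewrite mule_ge0// lee_fin powR_ge0.
- apply: ge0_emeasurable_sum => [i x _ _|i _].
    by rewrite mule_ge0// lee_fin powR_ge0.
  exact: emeasurable_funM.
- exact: emeasurable_funM.
move=> x _.
have -> : (p * S = a + p)%R by rewrite /a; ring.
rewrite poweRD; last by rewrite add_neq0_poweRD_def// gt_eqF// addr_gt0.
rewrite -(muleA (f x `^ a)) (muleA C3%:E).
rewrite (_ : (fun n => _) = (fun n => \sum_(0 <= i < n)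
  ((if ((L i / 2)%:E < f x)%E then L i `^ a else 0)%:E * (f x `^ p * tau x)))).
  rewrite nneseries_mulr; last 2 first.
  + by move=> i; case: ifP => _; rewrite ?powR_ge0.
  + by rewrite mule_ge0 ?poweR_ge0.
  rewrite lee_wpmul2r ?mule_ge0 ?poweR_ge0//.
  exact: nneseries_level_le.
apply/funext => n; apply: eq_bigr => i _; rewrite /g patchE.
case: ifPn => [|xU]; first by rewrite inE /= => ->.
rewrite [point](_ : _ = 0)// mule0 ifF ?mul0e//.
by apply/negbTE/negP => MU; move: xU; rewrite notin_setE.
Qed.

(* As [level N 0 = 2 ^- N], letting [N] grow exhausts the points where the
   maximal function is positive. *)
Lemma strong_type (S : R) : (1 < S)%R -> exists2 K' : R, (0 <= K')%R &
  forall f : T -> \bar R, measurable_fun setT f -> (forall x, 0 <= f x) ->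
  \int[mu]_(x in \bigcup_(Q in F) B Q) (sup_over (avg f) x `^ (p * r * S) * w x) <=
  K'%:E * (\int[mu]_x (f x `^ (p * S) * tau x)) `^ r.
Proof.
move=> S1; pose a := (p * (S - 1))%R.
exists (2 `^ (p * r * S) * (C * K * (2^-1 `^ (p * r))^-1) *
   ((2 `^ a - 1)^-1 * 2 `^ a * 2 `^ a) `^ r)%R.
  by rewrite !mulr_ge0 ?invr_ge0 ?powR_ge0.
move=> f mf f0; set M := sup_over _; set D := \bigcup_(Q in F) B Q.
have r0 : (0 < r)%R by rewrite (lt_le_trans _ r_ge1).
have e0 : (0 < p * r * S)%R by rewrite !mulr_gt0// (lt_trans _ S1).
have mM : measurable_fun setT M by exact: measurable_sup_over.
have mU t : measurable [set x | t%:E < M x].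
  by rewrite -[X in measurable X]setTI; exact: emeasurable_fun_o_infty.
have M0 x : D x -> 0 <= M x.
  move=> [Q FQ Qx]; apply: (@le_trans _ _ (avg f Q)).
    rewrite mule_ge0 ?lee_fin ?invr_ge0 ?(ltW (m_gt0 FQ))// integral_ge0// => ? _.
    by rewrite mule_ge0.
  by apply: ereal_sup_ubound; exists Q.
have mMw : measurable_fun setT (fun x => M x `^ (p * r * S) * w x).
  apply: emeasurable_funM => //.
  exact: (measurableT_comp (measurable_poweR _)).
have Mw0 x : 0 <= M x `^ (p * r * S) * w x by rewrite mule_ge0 ?poweR_ge0.
have posE : [set x | 0 < M x] = \bigcup_N [set x | (level N 0)%:E < M x].
  apply/seteqP; split=> [x /= Mx|x [N _ /=]]; last first.
    by apply: lt_trans; rewrite lte_fin level_gt0.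
  have [y y0 yM] : exists2 y : R, (0 < y)%R & y%:E <= M x.
    by case: (M x) Mx => [y| |] //; [exists y|exists 1%R; rewrite ?leey].
  exists (Num.truncn y^-1).+1 => //=; apply: lt_le_trans yM.
  rewrite lte_fin /level expr0 mul1r invf_plt ?posrE ?exprn_gt0//.
  rewrite (lt_le_trans (truncnS_gt _))// -(natrX _ 2 _.+1) ler_nat ltnW//.
  exact: ltn_expl.
(* On the rest of [D] one has [M = 0], and the integrand vanishes even where [w] is infinite. *)
apply: (@le_trans _ _ (\int[mu]_(x in [set x | 0 < M x]) (M x `^ (p * r * S) * w x))).
  have mD : measurable D by exact: measurable_bigcup_lindelof.
  rewrite (_ : \int[mu]_(x in D) _ = \int[mu]_(x in D `&` [set x | 0 < M x])
    (M x `^ (p * r * S) * w x)).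
    apply: ge0_le_integral_set => //; last exact: mU.
    by apply: measurableI => //; exact: mU.
  rewrite integral_mkcondr; apply: eq_integral => x; rewrite inE => Dx.
  rewrite patchE; case: ifPn => //; rewrite notin_setE /= => /negP; rewrite -leNgt => Mx.
  have -> : M x = 0 by apply/eqP; rewrite eq_le Mx M0.
  by rewrite poweR0r ?mul0e// gt_eqF.
rewrite posE; apply: ge0_integral_bigcup_le => // [|N].
  move=> i j ij; apply/subsetPset => x /=; apply: le_lt_trans.
  rewrite lee_fin /level ler_pM2l// lef_pV2 ?posrE ?exprn_gt0//.
  by rewrite ler_weXn2l// ler1n.
exact: strong_type_level.
Qed.

End strong_type.

(** * Local cubes and engulfing *)

Section dist_compl_theory.
Context {R : realType} {n : nat}.
Local Notation V := 'rV[R]_n.+1.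
Variables (Omega : set V) (beta : R).
Hypotheses (OmegaT : Omega <> setT) (beta0 : 0 < beta) (beta1 : beta < 1).
Local Notation dist := (dist_compl Omega).
Local Notation F := (cubes Omega beta).

Let compl_neq0 : ~` Omega !=set0.
Proof.
apply/set0P/eqP => O0; apply: OmegaT.
by rewrite -(setCK Omega) O0 setC0.
Qed.

Let has_inf_dist x : has_inf [set `|x - y| | y in ~` Omega].
Proof.
split; first by case: compl_neq0 => y Oy; exists `|x - y|, y.
by exists 0 => _ [y _ <-].
Qed.

Lemma dist_compl_ge0 x : 0 <= dist x.
Proof.
apply: lb_le_inf; first exact: (has_inf_dist x).1.
by move=> _ [y _ <-].
Qed.

Lemma dist_compl_lip x y : dist x <= dist y + `|x - y|.
Proof.
rewrite -lerBlDr; apply: lb_le_inf; first exact: (has_inf_dist y).1.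
move=> _ [z Oz <-]; rewrite lerBlDr.
apply: (@le_trans _ _ `|x - z|).
  by apply: ge_inf; [exact: (has_inf_dist x).2|exists z].
by rewrite [leRHS]addrC ler_distD.
Qed.

Lemma dist_compl_in x y : `|x - y| < dist x -> Omega y.
Proof.
move=> xy; apply: contrapT => Oy; move: xy; apply/negP; rewrite -leNgt.
by apply: ge_inf; [exact: (has_inf_dist x).2|exists y].
Qed.

Lemma cubes_sub Q : F Q -> cube Q `<=` Omega.
Proof.
move=> [_ /andP[Q0 Ql]] y /cube_normP Qy; apply: (@dist_compl_in Q.1).
rewrite (lt_trans Qy)// (lt_le_trans Ql)// ler_piMl ?dist_compl_ge0//.
exact: ltW.
Qed.

Lemma cubes_neq0 Q : F Q -> cube Q !=set0.
Proof.
by move=> [_ /andP[Q0 _]]; exists Q.1; apply/cube_normP; rewrite subrr normr0.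
Qed.

Lemma cubes_cover : open Omega -> \bigcup_(Q in F) cube Q = Omega.
Proof.
move=> oO; apply/seteqP; split=> [x [Q FQ Qx]|x Ox]; first exact: cubes_sub Qx.
move: oO; rewrite openE => /(_ _ Ox) /nbhs_ballP[e /= e0 xO].
have ed : e <= dist x.
  apply: lb_le_inf; first exact: (has_inf_dist x).1.
  move=> _ [y Oy <-]; rewrite leNgt; apply/negP => xye; apply: Oy; apply: xO.
  by apply/(cube_normP (x, e)).
have be : 0 < beta * e by rewrite mulr_gt0.
have bed : beta * e <= beta * dist x by rewrite ler_pM2l.
exists (x, beta * e / 2); last by apply/cube_normP => /=; rewrite subrr normr0; lra.
by split=> //=; apply/andP; split; lra.
Qed.

(** As [beta < 1], even the closed cube stays in Omega. This gives finite mass to local cubes,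
    weights being integrable on compact subsets. *)
Lemma cubes_compact Q : F Q ->
  exists K, [/\ compact K, K `<=` Omega & cube Q `<=` K].
Proof.
move=> FQ; exists (closed_ball Q.1 Q.2); have [_ /andP[Q0 Ql]] := FQ; split.
- apply: bounded_closed_compact; last exact: closed_ball_closed.
  exists (`|Q.1| + Q.2); split; first exact: num_real.
  move=> M QM y; rewrite closed_ballE// /closed_ball_ /= => Qy.
  rewrite (le_trans _ (ltW QM))// -[y](subrKC Q.1) (le_trans (ler_normD _ _))//.
  by rewrite lerD2l -opprB normrN.
- move=> y; rewrite closed_ballE// /closed_ball_ /= => Qy.
  apply: (@dist_compl_in Q.1); rewrite (le_lt_trans Qy)// (lt_le_trans Ql)//.
  by rewrite ler_piMl ?dist_compl_ge0// ltW.
- by move=> y Qy; exact: subset_closed_ball.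
Qed.

End dist_compl_theory.

(** * Cutting a cube into cells *)

Section finite_colouring.
Context {R : realType} {n : nat}.
Local Notation V := 'rV[R]_n.+1.

(** The colour of a point is its cell in a grid of mesh [r]. Colour classes are preferred to a fixed
    grid of small cubes because a class can be covered by a cube centred at one of its own points,
    and the later argument controls only cubes centred in the union of the neighbours. *)
Lemma cube_colouring (x0 : V) (a r : R) (k : nat) :
  0 < r -> 2 * a <= k%:R * r ->
  exists col : V -> {ffun 'I_n.+1 -> 'I_k.+1}, forall y z,
    cube (x0, a) y -> cube (x0, a) z -> col y = col z -> cube (y, r) z.
Proof.
move=> r0 akr.
pose t (y : V) (i : 'I_n.+1) : R := (y ord0 i - x0 ord0 i + a) / r.
exists (fun y => [ffun i => inord (Num.truncn (t y i))]) => y z ya za yz.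
have tP w i : cube (x0, a) w -> 0 <= t w i /\ (Num.truncn (t w i) < k.+1)%N.
  move=> /cubeP /(_ i) /=; rewrite ltr_norml => /andP[w1 w2].
  have tw0 : 0 <= t w i by rewrite /t divr_ge0 ?(ltW r0)//; lra.
  split=> //; rewrite truncn_lt_nat// /t ltr_pdivrMr//.
  rewrite (@lt_le_trans _ _ (2 * a))//; first lra.
  by rewrite (le_trans akr)// ler_pM2r// ler_nat.
apply/cubeP => i /=.
have [ty0 tyk] := tP y i ya; have [tz0 tzk] := tP z i za.
have := congr1 (fun g : {ffun 'I_n.+1 -> 'I_k.+1} => nat_of_ord (g i)) yz.
rewrite !ffunE !inordK// => tyz.
have /andP[y1 y2] := truncn_itv ty0; have /andP[z1 z2] := truncn_itv tz0.
rewrite tyz in y1 y2.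
have -> : y ord0 i - z ord0 i = (t y i - t z i) * r.
  by rewrite /t; field; rewrite gt_eqF.
rewrite normrM (gtr0_norm r0) gtr_pMl// ltr_norml.
by rewrite -natr1 in y2; rewrite -natr1 in z2; apply/andP; split; lra.
Qed.

End finite_colouring.

(** * From doubling to engulfing *)

Section engulfing_cubes.
Context {R : realType} {n : nat}.
Local Notation V := 'rV[R]_n.+1.
Local Notation L := (leb_rV R n).
Local Notation mu := (@lebesgue_rV R n).
Variables (Omega : set V) (beta : R).
Hypotheses (OmegaT : Omega <> setT) (beta0 : 0 < beta) (beta1 : beta < 1).
Local Notation dist := (dist_compl Omega).
Local Notation F := (cubes Omega beta).
Variables (w : L -> \bar R) (C : R).
Hypotheses (mw : measurable_fun setT w) (w0 : forall x, (0 <= w x)%E).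
Hypothesis C1 : 1 <= C.
Hypothesis dbl : forall Q, F Q -> F (double_cube Q) ->
  (\int[mu]_(x in cube (double_cube Q)) w x <= C%:E * \int[mu]_(x in cube Q) w x)%E.

Local Notation nu Q := (\int[mu]_(x in cube Q) w x)%E.

Let C0 : 0 <= C. Proof. exact: le_trans C1. Qed.

Let nu_mono (Q Q' : V * R) : cube Q `<=` cube Q' -> (nu Q <= nu Q')%E.
Proof.
by move=> QQ'; apply: ge0_le_integral_set => //; exact: measurable_cube.
Qed.

Let nu_ge0 (Q : V * R) : (0 <= nu Q)%E.
Proof. by apply: integral_ge0 => x _. Qed.

Lemma cube_convex (Q : V * R) x y t : cube Q x -> cube Q y -> 0 <= t <= 1 ->
  cube Q (x + t *: (y - x)).
Proof.
move=> /cube_normP Qx /cube_normP Qy /andP[t0 t1]; apply/cube_normP.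
have -> : Q.1 - (x + t *: (y - x)) = (1 - t) *: (Q.1 - x) + t *: (Q.1 - y).
  by apply/rowP => i; rewrite !mxE; ring.
rewrite (le_lt_trans (ler_normD _ _))// !normrZ.
rewrite !ger0_norm ?subr_ge0//.
have [->|tn0] := eqVneq t 0; first by rewrite mul0r addr0 subr0 mul1r.
have tt : 0 < t by rewrite lt_neqAle eq_sym tn0.
have -> : Q.2 = (1 - t) * Q.2 + t * Q.2 by ring.
by rewrite ler_ltD ?ler_wpM2l ?subr_ge0 ?(ltW Qx)// ltr_pM2l.
Qed.

(** Walk along the segment in [N] steps of length at most [r]: the cube at one point lies in the
    double of the cube at the previous point, so that each step costs a factor [C]. *)
Lemma doubling_chain (r : R) (N : nat) (x y : V) : 0 < r ->
  (forall t, 0 <= t <= 1 -> F (x + t *: (y - x), 2 * r)) ->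
  `|x - y| <= N%:R * r -> (nu (y, r) <= (C ^+ N)%:E * nu (x, r))%E.
Proof.
move=> r0; elim: N y => [|N IH] y Fr xy.
  by move: xy; rewrite mul0r normr_le0 subr_eq0 => /eqP ->; rewrite expr0 mul1e.
pose s : R := N%:R / N.+1%:R.
have s01 : 0 <= s <= 1.
  by rewrite /s divr_ge0//= ler_pdivrMr ?ltr0n// mul1r ler_nat.
pose z := x + s *: (y - x).
have Fz : F (z, 2 * r) by exact: Fr.
have Fz1 : F (z, r).
  by case: Fz => /= Oz /andP[h1 h2]; split=> //=; apply/andP; split; lra.
apply: (@le_trans _ _ (C%:E * nu (z, r))%E).
  apply: le_trans (dbl Fz1 Fz); apply: nu_mono => u /cube_normP /= yu.
  apply/cube_normP => /=.
  rewrite (le_lt_trans (ler_distD y _ _))// mulr_natl mulr2n ler_ltD//.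
  have -> : z - y = - (N.+1%:R^-1 *: (y - x)).
    apply/rowP => i; rewrite /z /s !mxE -natr1; field.
    by rewrite natr1 pnatr_eq0.
  rewrite normrN normrZ ger0_norm ?invr_ge0// distrC.
  by rewrite ler_pdivrMl ?ltr0n.
rewrite exprS EFinM -muleA lee_wpmul2l ?lee_fin//.
apply: IH => [t /andP[t0 t1]|].
  have -> : x + t *: (z - x) = x + (t * s) *: (y - x).
    by apply/rowP => i; rewrite /z !mxE; ring.
  apply: Fr; case/andP: s01 => s0 s1.
  by rewrite mulr_ge0//= mulr_ile1.
have -> : x - z = s *: (x - y).
  by apply/rowP => i; rewrite /z !mxE; ring.
rewrite normrZ ger0_norm; last by case/andP: s01.
rewrite /s mulrAC ler_pdivrMr ?ltr0n// -mulrA ler_wpM2l//.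
by rewrite [leRHS]mulrC.
Qed.

(* A cube [Q] with [4 Q] in the family is handled by doubling alone. Otherwise
   its half side is comparable to the distance [d0] of its center to the
   complement, and so is the distance from every point of [Q] and of its
   neighbours: there the cubes of half side [r ~ d0] have comparable measures,
   and boundedly many of them cover the neighbours. *)
Lemma engulfing_cubes :
  exists2 K : R, 0 <= K & engulfing mu F (cube : V * R -> set L) snd w K.
Proof.
have b0 : 0 < beta by [].
have b1 : 0 < 1 + beta by rewrite addr_gt0.
have b2 : 0 < 1 - beta by rewrite subr_gt0.
(* A lower bound, in units of [d0], for the distance to the complement on any neighbour. That
   distance loses at most a factor [1 - beta] from [x0] to a common point, [1 / (1 + beta)] from
   there to the center of the neighbour, and [1 - beta] again to any of its points. *)
pose kappa : R := (1 - beta) ^+ 2 / (1 + beta).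
have k0 : 0 < kappa by rewrite divr_gt0// exprn_gt0.
have k1 : kappa <= 1 - beta.
  by rewrite ler_pdivrMr// expr2 ler_pM2l//; lra.
(* For [r = beta * kappa * d0 / 4] the value 24 yields [N r >= 6 beta d0 > 6 l0], the side of the
   cube [(x0, 3 l0)] that contains all neighbours; chains inside a single cube are shorter. *)
pose N := (Num.truncn (24 / kappa)).+1.
have Nk : 24 <= N%:R * kappa.
  by rewrite -ler_pdivrMr// ltW// truncnS_gt.
pose colours := {ffun 'I_n.+1 -> 'I_N.+1}.
(* Two doublings reach [4 Q]. In the other case each colour costs a chain inside a neighbour
   followed by a chain inside [Q]. *)
exists (C ^+ 2 + #|colours|%:R * C ^+ (N + N)).
  by rewrite addr_ge0 ?mulr_ge0 ?exprn_ge0.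
move=> [x0 l0] s FQ sP; have [/= Ox0 /andP[l00 lb]] := FQ.
set d0 := dist x0 in lb.
have mS : measurable (\big[setU/set0]_(q <- s) cube q : set L).
  by apply: bigsetU_measurable => q _; exact: measurable_cube.
have sE y : (\big[setU/set0]_(q <- s) cube q) y -> exists q, q \in s /\ cube q y.
  by rewrite -bigcup_seq => -[q qs qy]; exists q.
rewrite EFinD ge0_muleDl ?lee_fin ?mulr_ge0 ?exprn_ge0//.
have near y : (\big[setU/set0]_(q <- s) cube q) y -> cube (x0, 3 * l0) y.
  move=> /sE[q [qs /cube_normP qy]].
  have [_ [z [/cube_normP qz /cube_normP /= xz]] /= ql] := sP q qs.
  apply/cube_normP => /=.
  rewrite (le_lt_trans (ler_distD z _ _))//.
  rewrite (le_lt_trans (lerD (lexx _) (ler_distD q.1 _ _)))//.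
  by rewrite (distrC z); lra.
have [l4|l4] := ltP (4 * l0) (beta * d0).
  apply: (@le_trans _ _ ((C ^+ 2)%:E * nu (x0, l0))%E); last first.
    by rewrite leeDl// mule_ge0// lee_fin mulr_ge0 ?exprn_ge0.
  have F2 : F (double_cube (x0, l0)).
    by split=> //=; apply/andP; split; rewrite -/d0; lra.
  have F4 : F (double_cube (double_cube (x0, l0))).
    by split=> //=; apply/andP; split; rewrite -/d0; lra.
  apply: (@le_trans _ _ (nu (double_cube (double_cube (x0, l0))))).
    apply: ge0_le_integral_set => //; first exact: measurable_cube.
    by move=> y /near /cube_normP /= h; apply/cube_normP => /=; lra.
  apply: (le_trans (dbl F2 F4)).
  by rewrite expr2 EFinM -muleA lee_wpmul2l ?lee_fin//; exact: dbl.
apply: (@le_trans _ _ ((#|colours|%:R * C ^+ (N + N))%:E * nu (x0, l0))%E); last first.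
  by rewrite leeDr// mule_ge0// lee_fin exprn_ge0.
have d00 : 0 < d0 by rewrite -(pmulr_rgt0 _ beta0); lra.
(* Then [2 r] is half of [beta * kappa * d0], which leaves room for the strict inequality in the
   family. *)
pose r : R := beta * kappa * d0 / 4.
have r0 : 0 < r by rewrite !mulr_gt0// invr_gt0.
have bd0 : 0 < beta * d0 by rewrite mulr_gt0.
have Nr : 6 * (beta * d0) <= N%:R * r.
  have -> : N%:R * r = (N%:R * kappa) * (beta * d0) / 4 by rewrite /r; field.
  rewrite ler_pdivlMr// mulrAC ler_pM2r//; lra.
(* The failure of [4 Q] to be in the family, that is [beta * d0 <= 4 * l0], enters here: chains may
   end at a cube inside [Q]. *)
have rl : r <= l0.
  have : kappa * (beta * d0) <= 1 * (beta * d0) by rewrite ler_pM2r//; lra.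
  rewrite /r; lra.
have Fr u : Omega u -> kappa * d0 <= dist u -> F (u, 2 * r).
  move=> Ou du; split=> //=; apply/andP; split; first lra.
  have : beta * (kappa * d0) <= beta * dist u by rewrite ler_pM2l.
  have : 0 < beta * (kappa * d0) by rewrite mulr_gt0// mulr_gt0.
  rewrite /r; lra.
have distQ u : cube (x0, l0) u -> (1 - beta) * d0 <= dist u.
  move=> /cube_normP /= xu; have := dist_compl_lip OmegaT x0 u.
  by rewrite -/d0; lra.
have FrQ u : cube (x0, l0) u -> F (u, 2 * r).
  move=> Qu; apply: Fr; first exact: (cubes_sub OmegaT beta1 FQ).
  by apply: le_trans (distQ _ Qu); rewrite ler_pM2r.
have Frs q u : q \in s -> cube q u -> F (u, 2 * r).
  move=> qs qu; have [Fq [z [qz xz]] _] := sP q qs.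
  apply: Fr; first exact: (cubes_sub OmegaT beta1 Fq).
  have [_ /andP[_ ql]] := Fq.
  move: qu qz => /cube_normP qu /cube_normP qz.
  have h1 := distQ _ xz.
  have h2 := dist_compl_lip OmegaT z q.1.
  have h3 := dist_compl_lip OmegaT q.1 u.
  rewrite distrC in h2.
  have h4 : (1 - beta) * d0 <= (1 + beta) * dist q.1 by lra.
  have h5 : (1 - beta) * dist q.1 <= dist u by lra.
  apply: le_trans h5; rewrite -(ler_pM2r b1).
  have -> : kappa * d0 * (1 + beta) = (1 - beta) * ((1 - beta) * d0).
    by rewrite /kappa; field; rewrite gt_eqF.
  by rewrite -mulrA ler_pM2l// [leRHS]mulrC.
have nuN y : (\big[setU/set0]_(q <- s) cube q) y ->
    (nu (y, r) <= (C ^+ (N + N))%:E * nu (x0, l0))%E.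
  move=> /sE[q [qs qy]]; have [_ [z [qz xz]] /= ql] := sP q qs.
  apply: (@le_trans _ _ ((C ^+ N)%:E * nu (z, r))%E).
    apply: doubling_chain => // [t t01|].
      by apply: (Frs q) => //; exact: cube_convex.
    move: qy qz => /cube_normP qy /cube_normP qz.
    rewrite (le_trans (ler_distD q.1 _ _))// (distrC z).
    have : 0 < beta * d0 by []. lra.
  rewrite exprD EFinM -muleA lee_wpmul2l ?lee_fin ?exprn_ge0//.
  apply: (@le_trans _ _ ((C ^+ N)%:E * nu (x0, r))%E).
    apply: doubling_chain => // [t t01|].
      by apply: FrQ; apply: cube_convex => //; apply/cube_normP; rewrite subrr normr0.
    move: xz => /cube_normP /= xz; lra.
  rewrite lee_wpmul2l ?lee_fin ?exprn_ge0//; apply: nu_mono.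
  by move=> u /cube_normP /= xu; apply/cube_normP => /=; lra.
have [col colP] := @cube_colouring R n x0 (3 * l0) r N r0 ltac:(lra).
have /choice[A AP] : forall c : colours, exists A : set L, [/\ measurable A,
    (\int[mu]_(x in A) w x <= (C ^+ (N + N))%:E * nu (x0, l0))%E &
    forall y, (\big[setU/set0]_(q <- s) cube q) y -> col y = c -> A y].
  move=> c; have [[y [ys yc]]|nex] := pselect (exists y,
      (\big[setU/set0]_(q <- s) cube q) y /\ col y = c).
    exists (cube (y, r)); split; [exact: measurable_cube|exact: nuN|].
    by move=> y' y's y'c; apply: colP; [exact: near|exact: near|rewrite yc].
  exists set0; split; first exact: measurable0.
    by rewrite integral_set0 mule_ge0// lee_fin exprn_ge0.
  by move=> y ys yc; apply: nex; exists y.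
apply: (@le_trans _ _ (\int[mu]_(x in \big[@setU L/set0]_(c <- enum colours) A c) w x)%E).
  apply: ge0_le_integral_set => //.
    by apply: bigsetU_measurable => c _; case: (AP c).
  move=> y ys; rewrite -bigcup_seq; exists (col y); first by rewrite /= mem_enum.
  by have [_ _] := AP (col y); apply.
have mA c : measurable (A c) by case: (AP c).
apply: (le_trans (ge0_integral_bigsetU_le _ mw w0 _ mA)).
apply: (@le_trans _ _ (\sum_(c <- enum colours) (C ^+ (N + N))%:E * nu (x0, l0))%E).
  by apply: lee_sum => c _; case: (AP c).
set z := (_%:E * _)%E; have z0 : (0 <= z)%E.
  by rewrite mule_ge0// lee_fin exprn_ge0.
rewrite EFinM -muleA -/z cardE.
suff -> : forall t : seq colours, (\sum_(c <- t) z)%E = ((size t)%:R%:E * z)%E by [].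
elim=> [|c t IH]; first by rewrite big_nil mul0e.
by rewrite big_cons IH /= -natr1 EFinD addeC ge0_muleDl ?lee_fin// mul1e.
Qed.

End engulfing_cubes.

(** * The two-weight estimate *)

Section hoelder_like.
Context d (T : measurableType d) (R : realType) (mu : {measure set T -> \bar R}).
Local Open Scope ereal_scope.

(** Either [f] is below the threshold [lam s], or [f^(p-1)] is at least [(lam s)^(p-1)]. This is an
    additive substitute for Hoelder's inequality that allows [f = +oo]. *)
Lemma young_threshold (f : \bar R) (s lam p : R) : 0 <= f -> (0 < s)%R ->
  (0 < lam)%R -> (1 < p)%R ->
  f <= (lam * s)%:E + (lam `^ (1 - p))%:E * (f `^ p * (s `^ (1 - p))%:E).
Proof.
move=> f0 s0 lam0 p1; have p0 : (0 < p)%R by rewrite (lt_trans _ p1).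
have ls : (0 < lam * s)%R by rewrite mulr_gt0.
have [fs|fs] := leP f (lam * s)%:E.
  rewrite (le_trans fs)// leeDl// !mule_ge0 ?poweR_ge0//; by rewrite lee_fin powR_ge0.
apply: (@le_trans _ _ ((lam `^ (1 - p))%:E * (f `^ p * (s `^ (1 - p))%:E))); last first.
  by rewrite leeDr// lee_fin ltW.
rewrite muleCA -EFinM -powRM ?(ltW lam0) ?(ltW s0)//.
case: f f0 fs => [f| |] // f0 fs; last first.
  by rewrite poweRyr ?gt_eqF// gt0_mulye// lte_fin powR_gt0.
rewrite poweR_EFin -EFinM lee_fin; rewrite lte_fin in fs.
have f00 : (0 < f)%R by rewrite (lt_trans ls).
have -> : (1 - p = - (p - 1))%R by ring.
rewrite powRN ler_pdivlMr ?powR_gt0//.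
rewrite -(mulr_powRB1 (ltW f00) p0).
rewrite ler_pM2l// ge0_ler_powR ?nnegrE ?subr_ge0 ?(ltW p1) ?(ltW ls) ?(ltW f00)//.
exact: ltW.
Qed.

(** Hoelder's inequality for [f s^(-1/p')] and [s^(1/p')], [p'] being the conjugate exponent, up to
    the factor [2^p]: integrate the threshold bound with [lam] such that [lam * m] is half of the
    left-hand integral, and absorb that half. *)
Lemma integral_powR_le (f : T -> \bar R) (s : T -> R) (p m : R) (A : set T) :
  measurable A -> measurable_fun setT f -> (forall x, 0 <= f x) ->
  measurable_fun setT s -> (forall x, (0 < s x)%R) -> (1 < p)%R ->
  (0 < m)%R -> \int[mu]_(x in A) (s x)%:E = m%:E ->
  (\int[mu]_(x in A) f x) `^ p <=
  (2 `^ p * m `^ (p - 1))%:E * \int[mu]_(x in A) (f x `^ p * (s x `^ (1 - p))%:E).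
Proof.
move=> mA mf f0 ms s0 p1 m0 sm; have p0 : (0 < p)%R by rewrite (lt_trans _ p1).
set J := \int[mu]_(x in A) f x; set X := \int[mu]_(x in A) _.
have msE : measurable_fun A (fun x => (s x)%:E).
  by apply/measurable_EFinP; exact: measurable_funTS.
have mX : measurable_fun A (fun x => f x `^ p * (s x `^ (1 - p))%:E).
  apply: measurable_funTS; apply: emeasurable_funM.
    exact: (measurableT_comp (measurable_poweR _)).
  by apply/measurable_EFinP; exact: (measurableT_comp (measurable_powR _)).
have X0 x : 0 <= f x `^ p * (s x `^ (1 - p))%:E.
  by rewrite mule_ge0 ?poweR_ge0// lee_fin powR_ge0.
have key lam : (0 < lam)%R -> J <= (lam * m)%:E + (lam `^ (1 - p))%:E * X.
  move=> lam0.
  apply: (@le_trans _ _ (\int[mu]_(x in A) ((lam%:E * (s x)%:E) +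
      (lam `^ (1 - p))%:E * (f x `^ p * (s x `^ (1 - p))%:E)))).
    apply: ge0_le_integral => //.
    - exact: measurable_funTS.
    - by apply: emeasurable_funD; apply: emeasurable_funM.
    - by move=> x _; rewrite -EFinM; exact: young_threshold.
  rewrite ge0_integralD//.
  - rewrite !ge0_integralZl// ?lee_fin ?powR_ge0//.
    + by rewrite sm -EFinM.
    + by move=> x _; rewrite lee_fin ltW.
    + exact: ltW.
  - by move=> x _; rewrite mule_ge0 ?lee_fin ?ltW.
  - exact: emeasurable_funM.
  - by move=> x _; rewrite mule_ge0// lee_fin powR_ge0.
  - exact: emeasurable_funM.
have cst0 : (0 < 2 `^ p * m `^ (p - 1))%R by rewrite mulr_gt0 ?powR_gt0.
have Xge0 : 0 <= X by exact: integral_ge0.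
have Jge0 : 0 <= J by exact: integral_ge0.
case: X Xge0 key => [X| |] // Xge0 key; last first.
  by rewrite gt0_muley ?lte_fin// leey.
(* The choice [lam = 1] shows that [J] is finite, so that half of it can be subtracted later. *)
have := key 1%R ltr01; rewrite mul1r powR1 mul1e -EFinD.
case: J Jge0 key => [J| |] // Jge0 key _.
move: Jge0 Xge0; rewrite !lee_fin le_eqVlt => /predU1P[<-|J0] Xge0.
  by rewrite powR0 ?gt_eqF// mulr_ge0// ltW.
have lam0 : (0 < J / (2 * m))%R by rewrite divr_gt0// mulr_gt0.
have := key _ lam0; rewrite -!EFinM -EFinD !lee_fin.
have -> : (J / (2 * m) * m = J / 2)%R by field; rewrite gt_eqF.
have -> : (1 - p = - (p - 1))%R by ring.
rewrite powRN => H.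
have H1 : (J / 2 <= X / (J / (2 * m)) `^ (p - 1))%R by rewrite mulrC; lra.
move: H1; rewrite ler_pdivlMr ?powR_gt0//.
have -> : (J / (2 * m) = (J / 2) / m)%R by field; rewrite gt_eqF.
rewrite powRM ?divr_ge0 ?invr_ge0 ?(ltW J0) ?(ltW m0)// mulrA.
rewrite mulr_powRB1 ?divr_ge0 ?(ltW J0)// powRM ?(ltW J0)//.
rewrite -powR_inv1 ?(ltW m0)// -powRrM mulN1r powRN.
rewrite ler_pdivrMr ?powR_gt0// => H2.

have <- : (2 `^ p * (J `^ p * 2^-1 `^ p) = J `^ p)%R.
  by rewrite mulrCA -powRM// ?invr_ge0// mulfV// powR1 mulr1.
by rewrite -mulrA ler_pM2l ?powR_gt0// [leRHS]mulrC.
Qed.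

End hoelder_like.

Lemma integral_cube_gt0 {R : realType} {n : nat} (s : leb_rV R n -> R)
    (Q : 'rV[R]_n.+1 * R) :
  measurable_fun setT s -> (forall x, 0 < s x) -> 0 < Q.2 ->
  (0 < \int[lebesgue_rV]_(x in (cube Q : set (leb_rV R n))) (s x)%:E)%E.
Proof.
move=> ms s0 Q0; rewrite lt_neqAle integral_ge0 ?andbT; last first.
  by move=> x _; rewrite lee_fin ltW.
apply/eqP => /esym s_eq0.
have mQ := measurable_cube Q.
have msQ : measurable_fun (cube Q : set (leb_rV R n)) (fun x => (s x)%:E).
  by apply/measurable_EFinP; exact: measurable_funTS.
have : (\int[lebesgue_rV]_(x in (cube Q : set (leb_rV R n))) `|(s x)%:E| = 0)%E.
  rewrite -[RHS]s_eq0; apply: eq_integral => x _.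
  by rewrite gee0_abs// lee_fin ltW.
move=> /(ae_eq_integral_abs _ mQ msQ)[N [mN N0 QN]].
have := lebesgue_rV_cube_gt0 Q0.
rewrite ltNge => /negP; apply; rewrite -N0; apply: le_measure; rewrite ?inE//.
move=> x Qx; apply: QN => /= /(_ Qx) [/eqP].
by rewrite gt_eqF.
Qed.

(** * The estimate for weights given by a positive real density *)

Section two_weights.
Context {R : realType} {n : nat}.
Local Notation V := 'rV[R]_n.+1.
Local Notation L := (leb_rV R n).
Local Notation mu := (@lebesgue_rV R n).
Variables (Omega : set V) (beta : R).
Hypotheses (oOmega : open Omega) (OmegaT : Omega <> setT).
Hypotheses (beta0 : 0 < beta) (beta1 : beta < 1).
Local Notation F := (cubes Omega beta).
Local Notation B := (cube : V * R -> set L).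
Variables (s : L -> R) (u : L -> \bar R) (p q : R).
Hypotheses (ms : measurable_fun setT s) (s_gt0 : forall x, 0 < s x).
Hypotheses (mu_u : measurable_fun setT u) (u_ge0 : forall x, (0 <= u x)%E).
Hypotheses (p_gt1 : 1 < p) (pq : p <= q).
Local Open Scope ereal_scope.

Let sE (x : L) : \bar R := (s x)%:E.
Let v (x : L) : \bar R := (s x `^ (1 - p))%:E.
Hypothesis s_fin : forall Q, F Q -> \int[mu]_(x in cube Q) sE x < +oo.
Variables (Cs Cu : R).
Hypotheses (Cs_ge0 : (0 <= Cs)%R) (Cu_ge0 : (0 <= Cu)%R).
Hypothesis eng_s : engulfing mu F B snd sE Cs.
Hypothesis eng_u : engulfing mu F B snd u Cu.

Let vol (Q : V * R) : R := fine (mu (cube Q)).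
Let mass (Q : V * R) : R := fine (\int[mu]_(x in cube Q) sE x).

Let mcube (Q : V * R) : measurable (B Q). Proof. exact: measurable_cube. Qed.

Let p_gt0 : (0 < p)%R. Proof. exact: lt_trans p_gt1. Qed.
Let q_gt0 : (0 < q)%R. Proof. exact: lt_le_trans pq. Qed.
Let qp_ge1 : (1 <= q / p)%R. Proof. by rewrite ler_pdivlMr// mul1r. Qed.

Let cube_radius Q : F Q -> (0 < Q.2)%R. Proof. by case=> _ /andP[]. Qed.

Let volE Q : mu (cube Q) = (vol Q)%:E.
Proof. by rewrite fineK// ge0_fin_numE// lebesgue_rV_cube_lty. Qed.

Let vol_gt0 Q : F Q -> (0 < vol Q)%R.
Proof. by move=> FQ; rewrite -lte_fin -volE lebesgue_rV_cube_gt0// cube_radius. Qed.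

Let msE : measurable_fun setT sE. Proof. exact/measurable_EFinP. Qed.

Let sE_ge0 x : 0 <= sE x. Proof. by rewrite lee_fin ltW. Qed.

Let mv : measurable_fun setT v.
Proof. by apply/measurable_EFinP; exact: (measurableT_comp (measurable_powR _)). Qed.

Let v_ge0 x : 0 <= v x. Proof. by rewrite lee_fin powR_ge0. Qed.

Let massE Q : F Q -> \int[mu]_(x in cube Q) sE x = (mass Q)%:E.
Proof.
by move=> FQ; rewrite fineK// ge0_fin_numE ?s_fin//; exact: integral_ge0.
Qed.

Let mass_gt0 Q : F Q -> (0 < mass Q)%R.
Proof.
by move=> FQ; rewrite -lte_fin -massE// integral_cube_gt0// cube_radius.
Qed.

Let lindelof (G : set (V * R)) : G !=set0 ->
  exists2 Q : nat -> V * R, (forall k, G (Q k)) &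
    \bigcup_(q in G) B q = \bigcup_k B (Q k).
Proof. exact: cube_lindelof. Qed.

Let B_neq0 Q : F Q -> B Q !=set0. Proof. exact: cubes_neq0. Qed.

(** Interpolation with [p = r = 1] and [S = p]: [mass Q] times the average over [Q] is the integral,
    so the test on one cube is an identity. *)
Lemma maximal_weighted : exists2 K : R, (0 <= K)%R &
  forall g : L -> \bar R, measurable_fun setT g -> (forall x, 0 <= g x) ->
  \int[mu]_(x in Omega) (sup_over F B (avg mu B mass sE g) x `^ p * sE x) <=
  K%:E * \int[mu]_x (g x `^ p * sE x).
Proof.
have test (g : L -> \bar R) Q : measurable_fun setT g -> (forall x, 0 <= g x) -> F Q ->
    \int[mu]_(x in B Q) sE x * avg mu B mass sE g Q `^ (1 * 1) <=
    1%:E * (\int[mu]_(x in B Q) (g x `^ 1 * sE x)) `^ 1.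
  move=> mg g0 FQ.
  have I0 : 0 <= \int[mu]_(x in B Q) (g x * sE x).
    by apply: integral_ge0 => x _; rewrite mule_ge0.
  rewrite mulr1 mul1e poweRe1; last first.
    by rewrite mule_ge0// lee_fin invr_ge0 ltW// mass_gt0.
  rewrite massE// /avg muleA -EFinM mulfV ?gt_eqF ?mass_gt0// mul1e.
  under [X in _ <= X `^ _]eq_integral => x _ do rewrite poweRe1//.
  by rewrite poweRe1.
have [K K0 H] := @strong_type _ _ R mu _ F B snd mcube B_neq0 lindelof mass sE mass_gt0
  msE sE_ge0 massE sE sE 1 1 Cs 1 msE sE_ge0 msE sE_ge0 ltr01 (lexx _) Cs_ge0 ler01
  eng_s test p p_gt1.
exists K => // g mg g0.
have := H g mg g0; rewrite (cubes_cover OmegaT beta0 beta1 oOmega) !mul1r.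
rewrite poweRe1//.
by apply: integral_ge0 => x _; rewrite mule_ge0 ?poweR_ge0.
Qed.

Variable CA : R.
Hypothesis Apq : forall Q, F Q ->
  (\int[mu]_(x in cube Q) u x) `^ (p / q) / mu (cube Q) *
  (\int[mu]_(x in cube Q) sE x / mu (cube Q)) `^ (p - 1) <= CA%:E.

Let one_ge0 (x : L) : 0 <= (cst 1 x : \bar R). Proof. exact: lee01. Qed.

Let volE1 Q : F Q -> \int[mu]_(x in cube Q) cst 1 x = (vol Q)%:E.
Proof. by move=> FQ; rewrite integral_cst// mul1e; exact: volE. Qed.

Let avg1E (f : L -> \bar R) Q :
  avg mu B vol (cst 1) f Q = (vol Q)^-1%:E * \int[mu]_(x in cube Q) f x.
Proof. by rewrite /avg; under eq_integral do rewrite mule1. Qed.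

(** Interpolation with [r = q / p] and [S = 2]. The test on one cube is Hoelder's inequality against
    [s] followed by A_{p,q}. *)
Lemma maximal_doubled_exponents : exists2 K : R, (0 <= K)%R &
  forall h : L -> \bar R, measurable_fun setT h -> (forall x, 0 <= h x) ->
  \int[mu]_(x in Omega) (sup_over F B (avg mu B vol (cst 1) h) x `^ (q * 2) * u x) <=
  K%:E * (\int[mu]_x (h x `^ (p * 2) * v x)) `^ (q / p).
Proof.
pose CA' := Num.max 0%R CA.
have CA'0 : (0 <= CA')%R by rewrite le_max lexx.
have pqE : (p * (q / p) = q)%R by rewrite mulrC divfK// gt_eqF.
pose K0 := ((CA' * 2 `^ p) `^ (q / p))%R.
have K00 : (0 <= K0)%R by exact: powR_ge0.
have test (f : L -> \bar R) Q : measurable_fun setT f -> (forall x, 0 <= f x) -> F Q ->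
    \int[mu]_(x in B Q) u x * avg mu B vol (cst 1) f Q `^ (p * (q / p)) <=
    K0%:E * (\int[mu]_(x in B Q) (f x `^ p * v x)) `^ (q / p).
  move=> mf f0 FQ; rewrite avg1E.
  have := integral_powR_le (mcube Q) mf f0 ms s_gt0 p_gt1 (mass_gt0 FQ) (massE FQ).
  set J := \int[mu]_(x in B Q) f x; set X := \int[mu]_(x in B Q) (f x `^ p * v x).
  rewrite -/X => JX.
  have J0 : 0 <= J by exact: integral_ge0.
  have X0 : 0 <= X by apply: integral_ge0 => x _; rewrite mule_ge0 ?poweR_ge0.
  have := Apq FQ; set U := \int[mu]_(x in B Q) u x; rewrite -/U => AQ.
  have U0 : 0 <= U by exact: integral_ge0.
  have vQ := vol_gt0 FQ; have mQ := mass_gt0 FQ.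
  (* With [U] in this form both sides are [q / p]-th powers; under the power, the factor in front of
     the integral of [f^p v] is [2^p] times the A_{p,q} quotient. *)
  have UE : U = (U `^ (p / q)) `^ (q / p).
    by rewrite -poweRrM mulrA divfK ?gt_eqF// divff ?gt_eqF// poweRe1.
  rewrite UE (poweRrM _ p (q / p)) -poweRM ?poweR_ge0//.
  rewrite (_ : K0%:E = (CA' * 2 `^ p)%:E `^ (q / p))// -poweRM//; last first.
    by rewrite lee_fin mulr_ge0 ?powR_ge0.
  apply: lee_poweR; first by rewrite (le_trans _ qp_ge1).
    by rewrite mule_ge0 ?poweR_ge0.
  rewrite poweRM//; last by rewrite lee_fin invr_ge0 ltW.
  set W := U `^ (p / q) in AQ *.
  have W0 : 0 <= W by exact: poweR_ge0.
  move: AQ; rewrite massE// volE inver gt_eqF// -EFinM poweR_EFin => AQ.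
  apply: (@le_trans _ _ (W * ((vol Q)^-1%:E `^ p *
      ((2 `^ p * mass Q `^ (p - 1))%:E * X)))).
    by rewrite lee_wpmul2l// lee_wpmul2l ?poweR_ge0.
  rewrite poweR_EFin.
  have -> : W * (((vol Q)^-1 `^ p)%:E * ((2 `^ p * mass Q `^ (p - 1))%:E * X)) =
    (W * (vol Q)^-1%:E * ((mass Q / vol Q) `^ (p - 1))%:E) * ((2 `^ p)%:E * X).
    rewrite -!muleA; congr (_ * _); rewrite !muleA -!EFinM; congr (_%:E * _).
    rewrite powRM ?invr_ge0 ?(ltW mQ) ?(ltW vQ)//.
    rewrite -(@mulr_powRB1 _ _ p) ?invr_ge0 ?(ltW vQ)//; ring.
  rewrite [in leRHS]EFinM -[leRHS]muleA lee_wpmul2r ?mule_ge0 ?lee_fin ?powR_ge0//.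
  by rewrite (le_trans AQ)// lee_fin le_max lexx orbT.
have [K K_0 H] := @strong_type _ _ R mu _ F B snd mcube B_neq0 lindelof vol (cst 1) vol_gt0
  (measurable_cst _) one_ge0 volE1 u v p (q / p) Cu K0 mu_u u_ge0 mv v_ge0 p_gt0 qp_ge1
  Cu_ge0 K00 eng_u test 2 (ltr1n _ 2).
exists K => // h mh h0.
by have := H h mh h0; rewrite (cubes_cover OmegaT beta0 beta1 oOmega) pqE.
Qed.

Variables (c delta : R).
Hypotheses (c_gt0 : (0 < c)%R) (delta_gt0 : (0 < delta)%R).
Hypothesis Ainf : forall Q (E : set L), F Q -> measurable E -> E `<=` cube Q ->
  \int[mu]_(x in E) sE x / \int[mu]_(x in cube Q) sE x <=
  c%:E * (mu E / mu (cube Q)) `^ delta.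

Let large (Q : V * R) : set L :=
  cube Q `&` [set x | (mass Q / (3 * vol Q) <= s x)%R].

Let mlarge Q : measurable (large Q).
Proof.
apply: measurableI => //; rewrite -[X in measurable X]setTI.
by have := ms measurableT (measurable_itv `[(mass Q / (3 * vol Q))%R, +oo[);
  rewrite preimage_itvcy.
Qed.

(* If the set where [s] is at least a third of its average over [Q] were a small
   part of [Q], it would carry at most a third of the mass of [Q] by the
   A_infty condition, and so would its complement in [Q]. *)
Lemma Ainfty_large : exists2 eta : R, (0 < eta)%R &
  forall Q, F Q -> (eta * vol Q)%:E <= mu (large Q).
Proof.
(* The solution of [c * eta^delta = 1/3]. *)
pose eta := ((3 * c)^-1 `^ delta^-1)%R.
exists eta => [|Q FQ]; first by rewrite powR_gt0// invr_gt0 mulr_gt0.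
have vQ := vol_gt0 FQ; have mQ := mass_gt0 FQ.
rewrite leNgt; apply/negP => Esmall.
pose E := large Q.
have EQ : E `<=` cube Q by move=> x [].
have := Ainf FQ (mlarge Q) EQ; rewrite -/E massE// volE.
have muE : mu E = (fine (mu E))%:E.
  by rewrite fineK// ge0_fin_numE// (lt_trans Esmall)// ltry.
have e0 : (0 <= fine (mu E))%R by exact: fine_ge0.
rewrite inver (gt_eqF mQ) muE inver (gt_eqF vQ) -[X in X `^ _]EFinM poweR_EFin -EFinM => HE.
have {}HE : \int[mu]_(x in E) sE x <= (mass Q / 3)%:E.
  move: HE; rewrite lee_pdivrMr// => /le_trans; apply.
  rewrite -EFinM lee_fin mulrC ler_pM2l//.
  have : ((fine (mu E) / vol Q) `^ delta <= (3 * c)^-1)%R.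
    apply: (@le_trans _ _ (eta `^ delta)%R); last first.
      by rewrite /eta -powRrM mulVf ?gt_eqF// powRr1// invr_ge0 mulr_ge0// ltW.
    rewrite ge0_ler_powR ?nnegrE ?powR_ge0 ?(ltW delta_gt0) ?divr_ge0 ?(ltW vQ)//.
    by rewrite ler_pdivrMr// ltW// -lte_fin -muE.
  move=> h; rewrite -(ler_pM2l c_gt0) in h; rewrite (le_trans h)//.
  by rewrite invfM mulrCA mulfV ?mulr1// gt_eqF.
pose D : set L := cube Q `\` E.
have mD : measurable D by apply: measurableD => //; exact: mlarge.
have HD : \int[mu]_(x in D) sE x <= (mass Q / 3)%:E.
  apply: (@le_trans _ _ (\int[mu]_(x in D) (cst (mass Q / (3 * vol Q))%:E) x)).
    apply: ge0_le_integral => //.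
    - exact: measurable_funTS.
    - move=> x [Qx Ex]; rewrite /sE lee_fin leNgt; apply/negP => h.
      by apply: Ex; split=> //=; exact: ltW.
  rewrite integral_cst//.
  apply: (@le_trans _ _ ((mass Q / (3 * vol Q))%:E * (vol Q)%:E)).
    rewrite lee_wpmul2l ?lee_fin ?divr_ge0 ?mulr_ge0 ?(ltW vQ) ?(ltW mQ)//.
    by rewrite -volE; apply: le_measure; rewrite ?inE// => x [].
  rewrite -EFinM lee_fin le_eqVlt; apply/orP; left; apply/eqP.
  by field; rewrite gt_eqF.
have : (mass Q)%:E <= (mass Q / 3)%:E + (mass Q / 3)%:E.
  rewrite -massE// (_ : cube Q = E `|` D :> set L); last by rewrite setDUK.
  apply: (le_trans (ge0_integral_setU_le _ msE sE_ge0 (mlarge Q) mD)).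
  exact: leeD.
rewrite -EFinD lee_fin; lra.
Qed.

Lemma maximal_two_weights : exists2 K : R, (0 <= K)%R &
  forall f : L -> \bar R, measurable_fun setT f -> (forall x, 0 <= f x) ->
  \int[mu]_(x in Omega) (sup_over F B (avg mu B vol (cst 1) f) x `^ q * u x) <=
  K%:E * (\int[mu]_x (f x `^ p * v x)) `^ (q / p).
Proof.
have [eta eta0 etaP] := Ainfty_large.
have [K1 K10 K1P] := maximal_weighted.
have [K2 K20 K2P] := maximal_doubled_exponents.
(* With [J] the integral of [f] over [Q], on [large Q] the function [h] is at least [(J / mass Q) *
   (mass Q / (3 * vol Q)) = J / (3 * vol Q)]. The average of [h^(1/2)] over [Q] is then at least
   [eta] times the root of this, and squaring produces [K3]. *)
pose K3 := (3 * (eta^-1 `^ 2))%R.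
have K30 : (0 <= K3)%R by rewrite mulr_ge0 ?powR_ge0.
have mOmega : measurable (Omega : set L) by exact: measurable_open_rV.
have msup a : measurable_fun setT (sup_over F B a : L -> \bar R).
  by apply: measurable_sup_over; [exact: mcube|exact: lindelof].
have mpow e (k : L -> \bar R) : measurable_fun setT k ->
    measurable_fun setT (fun x => k x `^ e * u x).
  move=> mk; apply: emeasurable_funM; last exact: mu_u.
  exact: (measurableT_comp (measurable_poweR e)).
exists (K3 `^ q * (K2 * K1 `^ (q / p)))%R; first by rewrite !mulr_ge0 ?powR_ge0.
move=> f mf f0.
pose g (x : L) := f x * ((s x)^-1)%:E.
have msV : measurable_fun setT (fun x => (s x)^-1%:E).
  apply/measurable_EFinP; under eq_fun do rewrite -powR_inv1 ?(ltW (s_gt0 _))//.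
  exact: (measurableT_comp (measurable_powR _)).
have mg : measurable_fun setT g by exact: emeasurable_funM.
have g0 x : 0 <= g x by rewrite mule_ge0// lee_fin invr_ge0 ltW.
have gs x : g x * sE x = f x.
  by rewrite /g -muleA -EFinM mulVf ?mule1// gt_eqF.
have gps x : g x `^ p * sE x = f x `^ p * v x.
  rewrite /g poweRM ?lee_fin ?invr_ge0 ?(ltW (s_gt0 _))// poweR_EFin -muleA -EFinM.
  congr (_ * _%:E); rewrite -powR_inv1 ?(ltW (s_gt0 _))// -powRrM mulN1r.
  rewrite -{2}(powRr1 (ltW (s_gt0 x))) -powRD 1?addrC//.
  by rewrite (gt_eqF (s_gt0 x)) implybT.
pose G := sup_over F B (avg mu B mass sE g).
have mG : measurable_fun setT G by exact: msup.
have inF x : Omega x -> exists2 Q, F Q & cube Q x.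
  by rewrite -[X in X x -> _](cubes_cover OmegaT beta0 beta1 oOmega) => -[Q ? ?]; exists Q.
have avg_ge0 (m : V * R -> R) rho (k : L -> \bar R) Q : (0 < m Q)%R ->
    (forall x, 0 <= rho x) -> (forall x, 0 <= k x) -> 0 <= avg mu B m rho k Q.
  move=> mQ r0 k0; rewrite mule_ge0 ?lee_fin ?invr_ge0 ?(ltW mQ)//.
  by apply: integral_ge0 => x _; rewrite mule_ge0.
have le_sup a Q x : F Q -> cube Q x -> a Q <= sup_over F B a x.
  by move=> FQ Qx; apply: ereal_sup_ubound; exists Q.
have G0 x : Omega x -> 0 <= G x.
  move=> /inF[Q FQ Qx]; apply: (@le_trans _ _ (avg mu B mass sE g Q)); last exact: le_sup.
  by apply: avg_ge0 => //; exact: mass_gt0.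
(* Cut off outside Omega, where [G] is [-oo]. *)
pose h : L -> \bar R := (fun x => G x * sE x) \_ Omega.
have h0 x : 0 <= h x.
  by rewrite /h patchE; case: ifPn => // /set_mem Ox; rewrite mule_ge0// G0.
have mh : measurable_fun setT h.
  apply/(measurable_restrictT _ mOmega); apply: measurable_funTS.
  exact: emeasurable_funM.
pose H (x : L) := h x `^ 2^-1.
have H0 x : 0 <= H x by exact: poweR_ge0.
have mH : measurable_fun setT H by exact: (measurableT_comp (measurable_poweR _)).
(* The doubled exponent undoes the root, and [s^p s^(1-p) = s]. *)
have HvE : \int[mu]_x (H x `^ (p * 2) * v x) = \int[mu]_(x in Omega) (G x `^ p * sE x).
  rewrite [RHS]integral_mkcond; apply: eq_integral => x _.
  rewrite /H -poweRrM mulrCA mulVf// mulr1 /h !patchE; case: ifPn => [/set_mem Ox|_].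
    rewrite poweRM ?G0// poweR_EFin -muleA -EFinM; congr (_ * _%:E).
    by rewrite -powRD subrKC ?powRr1 ?(ltW (s_gt0 x))// oner_eq0.
  by rewrite poweR0r ?mul0e// gt_eqF.
pose M1H := sup_over F B (avg mu B vol (cst 1) H).
have M1H0 x : Omega x -> 0 <= M1H x.
  move=> /inF[Q FQ Qx].
  apply: (@le_trans _ _ (avg mu B vol (cst 1) H Q)); last exact: le_sup.
  by apply: avg_ge0 => //; exact: vol_gt0.
have pointwise x : Omega x ->
    sup_over F B (avg mu B vol (cst 1) f) x <= K3%:E * M1H x `^ 2.
  move=> Ox; apply: ge_ereal_sup => _ [Q [FQ Qx] <-].
  have vQ := vol_gt0 FQ; have mQ := mass_gt0 FQ.
  rewrite avg1E; set J := \int[mu]_(y in _) f y.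
  have J0 : 0 <= J by exact: integral_ge0.
  have z0 : 0 <= (3 * vol Q)^-1%:E * J.
    by rewrite mule_ge0// lee_fin invr_ge0 mulr_ge0// ltW.
  have large_h y : large Q y -> (3 * vol Q)^-1%:E * J <= h y.
    move=> [Qy /= sy]; have Oy : Omega y by exact: (cubes_sub OmegaT beta1 FQ).
    rewrite /h patchE mem_set//.
    have -> : (3 * vol Q)^-1%:E * J =
        ((mass Q)^-1%:E * J) * (mass Q / (3 * vol Q))%:E.
      rewrite muleAC -EFinM; congr (_%:E * _).
      by field; rewrite (gt_eqF mQ) (gt_eqF vQ).
    apply: lee_pmul => //.
    - by rewrite mule_ge0// lee_fin invr_ge0 ltW.
    - by rewrite lee_fin divr_ge0 ?mulr_ge0 ?(ltW mQ) ?(ltW vQ).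
    apply: (@le_trans _ _ (avg mu B mass sE g Q)); last exact: le_sup.
    rewrite /avg lee_wpmul2l ?lee_fin ?invr_ge0 ?(ltW mQ)//.
    by rewrite le_eqVlt; apply/orP; left; apply/eqP; apply: eq_integral => z _; rewrite gs.
  have avgH : eta%:E * ((3 * vol Q)^-1%:E * J) `^ 2^-1 <= avg mu B vol (cst 1) H Q.
    rewrite avg1E lee_pdivlMl// muleA -EFinM mulrC.
    apply: (@le_trans _ _ (\int[mu]_(y in large Q) (cst (((3 * vol Q)^-1%:E * J) `^ 2^-1) y))).
      rewrite integral_cst; last exact: mlarge.
      by rewrite [leRHS]muleC lee_wpmul2r ?poweR_ge0// etaP.
    apply: (@le_trans _ _ (\int[mu]_(y in large Q) H y)).
      apply: ge0_le_integral => //.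
      - by move=> y _; exact: poweR_ge0.
      - exact: measurable_funTS.
      - by move=> y /large_h hy; apply: lee_poweR; rewrite ?invr_ge0.
    apply: ge0_le_integral_set => //; by move=> y [].
  have -> : (vol Q)^-1%:E * J = 3%:E * ((3 * vol Q)^-1%:E * J).
    by rewrite muleA -EFinM; congr (_%:E * _); field; rewrite gt_eqF.
  rewrite /K3 EFinM -muleA lee_wpmul2l ?lee_fin//.
  rewrite -poweR_EFin -poweRM ?M1H0 ?lee_fin ?invr_ge0 ?(ltW eta0)//.
  have -> : (3 * vol Q)^-1%:E * J = (((3 * vol Q)^-1%:E * J) `^ 2^-1) `^ 2.
    by rewrite -poweRrM mulVf// poweRe1.
  apply: lee_poweR => //; first exact: poweR_ge0.
  rewrite lee_pdivlMl//; apply: (le_trans avgH); apply: ereal_sup_ubound.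
  by exists Q.
apply: (@le_trans _ _ (\int[mu]_(x in Omega)
    ((K3 `^ q)%:E * (M1H x `^ (q * 2) * u x)))).
  apply: (ge0_le_integral _ mOmega).
  - by move=> x _; apply: mule_ge0; [exact: poweR_ge0|exact: u_ge0].
  - by apply: measurable_funTS; apply: mpow; exact: msup.
  - apply: measurable_funTS; apply: emeasurable_funM; first exact: measurable_cst.
    by apply: mpow; exact: msup.
  move=> x Ox; rewrite muleA lee_wpmul2r//.
  have -> : (K3 `^ q)%:E * M1H x `^ (q * 2) = (K3%:E * M1H x `^ 2) `^ q.
    by rewrite poweRM ?lee_fin ?poweR_ge0// -poweRrM (mulrC 2%R).
  apply: lee_poweR; [exact: ltW| |exact: pointwise].
  have [Q FQ Qx] := inF x Ox.
  apply: (@le_trans _ _ (avg mu B vol (cst 1) f Q)); last exact: le_sup.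
  by apply: avg_ge0 => //; exact: vol_gt0.
rewrite (ge0_integralZl _ mOmega); last 3 first.
- by apply: measurable_funTS; apply: mpow; exact: msup.
- by move=> x _; apply: mule_ge0; [exact: poweR_ge0|exact: u_ge0].
- by rewrite lee_fin powR_ge0.
rewrite EFinM -muleA lee_wpmul2l ?lee_fin ?powR_ge0//.
apply: (le_trans (K2P H mH H0)); rewrite EFinM -muleA lee_wpmul2l ?lee_fin//.
rewrite HvE -poweR_EFin -poweRM ?lee_fin//; last first.
  by apply: integral_ge0 => x _; rewrite mule_ge0 ?poweR_ge0.
apply: lee_poweR; first by rewrite (le_trans _ qp_ge1).
  by apply: integral_ge0 => x _; rewrite mule_ge0 ?poweR_ge0.
apply: (le_trans (K1P g mg g0)).
by under eq_integral => x _ do rewrite gps.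
Qed.

End two_weights.

(** * Weights with extended values *)

Section weights_theory.
Context {R : realType} {n : nat}.
Local Notation V := 'rV[R]_n.+1.
Local Notation L := (leb_rV R n).
Local Notation mu := (@lebesgue_rV R n).
Variables (Omega : set V) (beta : R).
Hypotheses (oOmega : open Omega) (Omega0 : Omega !=set0) (OmegaT : Omega <> setT).
Hypotheses (beta0 : 0 < beta) (beta1 : beta < 1).
Local Notation F := (cubes Omega beta).
Local Open Scope ereal_scope.

Let mOmega : measurable (Omega : set L). Proof. exact: measurable_open_rV. Qed.

Lemma weight_cube_lty (w : V -> \bar R) Q : weight Omega w -> F Q ->
  wmeas w (cube Q) < +oo.
Proof.
move=> [mw w0 wK] FQ; have [K [cK KO QK]] := cubes_compact OmegaT beta1 FQ.
apply: le_lt_trans (wK K KO cK).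
have mK : measurable (K : set L).
  rewrite -[K]setCK; apply: measurableC; apply: measurable_open_rV.
  by apply: closed_openC; apply: compact_closed cK; exact: norm_hausdorff.
apply: ge0_subset_integral => //.
- exact: measurable_cube.
- exact: measurable_funS mw.
- by move=> x Kx; apply: w0; exact: KO.
Qed.

(** A weight is integrable, hence almost everywhere finite, on each local cube, and countably many
    of these cover Omega. *)
Lemma weight_pinfty_null (w : V -> \bar R) : weight Omega w ->
  mu (Omega `&` [set x | w x = +oo]) = 0.
Proof.
move=> ww; have [mw w0 _] := ww.
have mE : measurable (Omega `&` [set x | w x = +oo] : set L).
  exact: (mw mOmega [set +oo] (emeasurable_set1 _)).
apply/(negligibleP mu mE).
have F0 : F !=set0.
  case: Omega0 => x; rewrite -[X in X x](cubes_cover OmegaT beta0 beta1 oOmega).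
  by case=> Q FQ _; exists Q.
have [Q FQ QE] := cube_lindelof F0.
rewrite (cubes_cover OmegaT beta0 beta1 oOmega) in QE.
rewrite {1}QE setI_bigcupl; apply: negligible_bigcup => k.
have mQ : measurable (cube (Q k) : set L) by exact: measurable_cube.
have QO : cube (Q k) `<=` Omega by exact: (cubes_sub OmegaT beta1 (FQ k)).
have wint : mu.-integrable (cube (Q k)) w.
  apply/integrableP; split; first exact: measurable_funS mw.
  apply: le_lt_trans (weight_cube_lty ww (FQ k)).
  rewrite le_eqVlt; apply/orP; left; apply/eqP; apply: eq_integral => x.
  by rewrite inE => /QO Ox; rewrite gee0_abs// w0.
have [N [mN N0 QN]] := integrable_ae mQ wint.
by exists N; split=> // x [Qx /= wx]; apply: QN => /= /(_ Qx); rewrite wx.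
Qed.

Lemma D_class_engulfing (w : V -> \bar R) (w' : L -> \bar R) :
  D_class Omega beta w -> measurable_fun setT w' -> (forall x, 0 <= w' x) ->
  (forall Q, F Q -> \int[mu]_(x in cube Q) w' x = wmeas w (cube Q)) ->
  exists2 K : R, (0 <= K)%R &
    engulfing mu F (cube : V * R -> set L) snd w' K.
Proof.
move=> [ww [C CP]] mw' w'0 ww'.
apply: (@engulfing_cubes _ _ Omega beta OmegaT beta0 beta1 w' (Num.max 1%R C)) => //.
  by rewrite le_max lexx.
move=> Q FQ FQ2; rewrite !ww'//.
have /andP[+ _] := CP Q FQ FQ2; move=> /le_trans; apply.
rewrite lee_wpmul2r ?lee_fin ?le_max ?lexx ?orbT//.
by rewrite -ww'//; exact: integral_ge0.
Qed.

(* Almost everywhere in Omega both v and sigma are positive and finite, so they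
   may be replaced by powers of a positive real function. *)
Lemma sigma_weight_density (p : R) (v : V -> \bar R) : (1 < p)%R ->
  weight Omega v -> weight Omega (sigma_weight p v) ->
  exists (s : L -> R) (Z : set L), [/\ measurable_fun setT s,
    (forall x, 0 < s x)%R, measurable Z, mu (Omega `\` Z) = 0 &
    forall x, Z x -> sigma_weight p v x = (s x)%:E /\
                     v x = (s x `^ (1 - p))%:E].
Proof.
move=> p1 wv ws; have [mv v0 _] := wv; have [msig sig0 _] := ws.
have p10 : (p - 1 != 0)%R by rewrite subr_eq0 gt_eqF.
pose Zv : set L := Omega `&` [set x | v x = +oo].
pose Zs : set L := Omega `&` [set x | sigma_weight p v x = +oo].
have mZv : measurable Zv by exact: (mv mOmega [set +oo] (emeasurable_set1 _)).
have mZs : measurable Zs by exact: (msig mOmega [set +oo] (emeasurable_set1 _)).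
pose Z : set L := Omega `\` (Zv `|` Zs).
have mZ : measurable Z by apply: measurableD => //; exact: measurableU.
(* The indicator gives the value 1 off [Z]: [s] is then positive on the whole space, and so are its
   negative powers. *)
pose s (x : L) : R := (fine ((sigma_weight p v \_ Z) x) + \1_(~` Z) x)%R.
have sZ x : Z x -> s x = fine (sigma_weight p v x).
  move=> Zx; rewrite /s patchE mem_set// indicE memNset ?addr0//.
have sNZ x : ~ Z x -> s x = 1%R.
  by move=> Zx; rewrite /s patchE memNset// indicE mem_set//= add0r.
have ZP x : Z x -> exists2 y : R, (0 < y)%R & v x = y%:E.
  move=> [Ox Zx]; have := v0 x Ox.
  case E : (v x) => [y| |] //; last by case: Zx; left.
  rewrite lee_fin le_eqVlt => /predU1P[y0|y0]; last by exists y.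
  (* A zero of [v] is a point where sigma is [+oo], and [Z] excludes these. *)
  case: Zx; right; split=> //=; rewrite /sigma_weight E -y0 poweR0r ?inve0//.
  by rewrite invr_eq0.
have sE x : Z x -> sigma_weight p v x = (s x)%:E /\ v x = (s x `^ (1 - p))%:E /\ (0 < s x)%R.
  move=> Zx; have [y y0 vy] := ZP x Zx; rewrite sZ//.
  have y'0 : (0 < y `^ (p - 1)^-1)%R by exact: powR_gt0.
  rewrite /sigma_weight vy poweR_EFin inver gt_eqF//= invr_gt0; split=> //; split=> //.
  congr EFin; rewrite -powRN -powRrM mulNr -mulrN opprB mulVf//.
  by rewrite powRr1// ltW.
exists s, Z; split.
- apply: measurable_funD.
    apply: (measurableT_comp (fine_measurable measurableT)).
    by apply/(measurable_restrictT _ mZ); apply: measurable_funS msig => // x [].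
  by apply: measurable_indic; exact: measurableC.
- move=> x; have [Zx|Zx] := pselect (Z x); last by rewrite sNZ.
  by case: (sE x Zx) => _ [].
- exact: mZ.
- apply: measure_negligible; first exact: measurableD.
  apply: (@negligibleS _ _ _ mu (Zv `|` Zs)).
    by move=> x [Ox Zx]; apply: contrapT => nZ; apply: Zx.
  by apply: negligibleU; [apply/(negligibleP mu mZv)|apply/(negligibleP mu mZs)];
    exact: weight_pinfty_null.
- by move=> x /sE[? []].
Qed.

End weights_theory.

(** * The two implications for extended-valued weights *)

Section characterization.
Context {R : realType} {n : nat}.
Local Notation V := 'rV[R]_n.+1.
Local Notation L := (leb_rV R n).
Local Notation mu := (@lebesgue_rV R n).
Variables (Omega : set V) (beta p q : R) (u v : V -> \bar R).
Hypotheses (oOmega : open Omega) (OmegaT : Omega <> setT).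
Hypotheses (beta0 : 0 < beta) (beta1 : beta < 1).
Hypotheses (p_gt1 : 1 < p) (pq : p <= q).
Hypotheses (wu : weight Omega u) (wv : weight Omega v).
Hypothesis wsigma : weight Omega (sigma_weight p v).
Variables (s : L -> R) (Z : set L).
Hypotheses (ms : measurable_fun setT s) (s_gt0 : forall x, 0 < s x).
Hypothesis mZ : measurable Z.
Hypothesis null_Z : mu (Omega `\` Z) = 0%E.
Hypothesis sZ : forall x, Z x ->
  sigma_weight p v x = (s x)%:E /\ v x = (s x `^ (1 - p))%:E.
Local Notation F := (cubes Omega beta).
Local Notation B := (cube : V * R -> set L).
Local Open Scope ereal_scope.

Let mOmega : measurable (Omega : set L). Proof. exact: measurable_open_rV. Qed.

Let mcube (Q : V * R) : measurable (B Q). Proof. exact: measurable_cube. Qed.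

Let cubeO Q : F Q -> cube Q `<=` Omega. Proof. exact: cubes_sub. Qed.

Let p_gt0 : (0 < p)%R. Proof. exact: lt_trans p_gt1. Qed.
Let q_gt0 : (0 < q)%R. Proof. exact: lt_le_trans pq. Qed.

Let msE : measurable_fun setT (fun x : L => (s x)%:E).
Proof. exact/measurable_EFinP. Qed.

Let msp : measurable_fun setT (fun x : L => (s x `^ (1 - p))%:E).
Proof. by apply/measurable_EFinP; exact: (measurableT_comp (measurable_powR _)). Qed.

Let sigmaE (A : set L) : measurable A -> A `<=` Omega ->
  wmeas (sigma_weight p v) A = \int[mu]_(x in A) (s x)%:E.
Proof.
move=> mA AO; have [mw w0 _] := wsigma; apply: ge0_ae_eq_integral => //.
- exact: measurable_funS mw.
- exact: measurable_funTS.
- by move=> x /AO; exact: w0.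
- by move=> x _; rewrite lee_fin ltW.
exists (Omega `\` Z); split=> //; first exact: measurableD.
move=> x /= nx; have [Ax nsx] : A x /\ sigma_weight p v x <> (s x)%:E.
  by apply/not_implyP.
by split; [exact: AO|move=> /sZ[]].
Qed.

Let vE (k : L -> \bar R) : measurable_fun (Omega : set L) k -> (forall x, 0 <= k x) ->
  \int[mu]_(x in Omega) (k x * v x) = \int[mu]_(x in Omega) (k x * (s x `^ (1 - p))%:E).
Proof.
move=> mk k0; have [mw w0 _] := wv; apply: ge0_ae_eq_integral => //.
- exact: emeasurable_funM.
- by apply: emeasurable_funM => //; exact: measurable_funTS.
- by move=> x Ox; rewrite mule_ge0// w0.
- by move=> x _; rewrite mule_ge0// lee_fin powR_ge0.
exists (Omega `\` Z); split=> //; first exact: measurableD.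
move=> x /= /not_implyP[Ox nsx].
by split => // /sZ[_ vx]; apply: nsx; rewrite vx.
Qed.

(** The estimates above concern functions that are measurable on the whole space, whereas a weight
    is controlled on Omega only. *)
Let u' : L -> \bar R := u \_ Omega.

Let mu' : measurable_fun setT u'.
Proof. by case: wu => mw _ _; apply/(measurable_restrictT _ mOmega). Qed.

Let u'_ge0 x : 0 <= u' x.
Proof. by case: wu => _ w0 _; rewrite /u' patchE; case: ifPn => // /set_mem/w0. Qed.

Let u'E (A : set L) : A `<=` Omega -> \int[mu]_(x in A) u' x = wmeas u A.
Proof.
by move=> AO; apply: eq_integral => x /set_mem Ax; rewrite /u' patchE mem_set//; exact: AO.
Qed.

Let vol_gt0 Q : F Q -> 0 < mu (cube Q).
Proof. by move=> [_ /andP[Q0 _]]; exact: lebesgue_rV_cube_gt0. Qed.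

Let volE Q : mu (cube Q) = (fine (mu (cube Q)))%:E.
Proof. by rewrite fineK// ge0_fin_numE// lebesgue_rV_cube_lty. Qed.

Let fvol_gt0 Q : F Q -> (0 < fine (mu (cube Q)))%R.
Proof. by move=> FQ; rewrite -lte_fin -volE vol_gt0. Qed.

Let s_fin Q : F Q -> \int[mu]_(x in cube Q) (s x)%:E < +oo.
Proof.
move=> FQ; rewrite -sigmaE//; last exact: cubeO.
exact: (weight_cube_lty oOmega OmegaT beta1 wsigma FQ).
Qed.

(** Local cubes lie in Omega, so cutting [f] off there changes no average; it makes [f] measurable
    on the whole space. *)
Let maximalE (f : V -> R) :
  maximal_op Omega beta f = sup_over F B (avg mu B (fun Q => fine (mu (cube Q))) (cst 1)
    ((fun x => `|f x|%:E) \_ Omega)).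
Proof.
apply/funext => x; congr ereal_sup; apply: eq_imagel => Q [FQ _].
rewrite /avg {1}volE inver gt_eqF ?fvol_gt0//; congr (_ * _).
apply: eq_integral => y /set_mem Qy; rewrite mule1 patchE mem_set//.
exact: cubeO FQ _ Qy.
Qed.

Let maximal_ge0 (f : V -> R) x : Omega x -> 0 <= maximal_op Omega beta f x.
Proof.
rewrite -[X in X x -> _](cubes_cover OmegaT beta0 beta1 oOmega) => -[Q FQ Qx].
apply: (@le_trans _ _ ((mu (cube Q))^-1 * \int[mu]_(y in cube Q) `|f y|%:E)).
  by rewrite mule_ge0 ?inve_ge0//; apply: integral_ge0 => y _; rewrite lee_fin.
by apply: ereal_sup_ubound; exists Q.
Qed.

Lemma bounded_of_Apq : D_class Omega beta (sigma_weight p v) -> D_class Omega beta u ->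
  Ainfty_class Omega beta (sigma_weight p v) -> Apq_class Omega beta p q u v ->
  bounded_op Omega p q v u (maximal_op Omega beta).
Proof.
move=> Ds Du [_ [c [delta [c0 delta0 HA]]]] [CA HCA].
have [Cs Cs0 eng_s] := D_class_engulfing OmegaT beta0 beta1 Ds msE
  (fun x => ltW (s_gt0 x)) (fun Q FQ => esym (sigmaE (mcube Q) (cubeO FQ))).
have [Cu Cu0 eng_u] := D_class_engulfing OmegaT beta0 beta1 Du mu' u'_ge0
  (fun Q FQ => u'E (cubeO FQ)).
have HCA' Q : F Q -> (\int[mu]_(x in cube Q) u' x) `^ (p / q) / mu (cube Q) *
    (\int[mu]_(x in cube Q) (s x)%:E / mu (cube Q)) `^ (p - 1) <= CA%:E.
  move=> FQ; rewrite u'E; last exact: cubeO.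
  by rewrite -sigmaE//; [exact: HCA|exact: cubeO].
have HA' Q (E : set L) : F Q -> measurable E -> E `<=` cube Q ->
    \int[mu]_(x in E) (s x)%:E / \int[mu]_(x in cube Q) (s x)%:E <=
    c%:E * (mu E / mu (cube Q)) `^ delta.
  move=> FQ mE EQ; rewrite -!sigmaE//; [exact: HA|exact: cubeO|].
  exact: subset_trans EQ (cubeO FQ).
have [K K0 HK] := @maximal_two_weights R n Omega beta oOmega OmegaT beta0 beta1
  s u' p q ms s_gt0 mu' u'_ge0 p_gt1 pq s_fin Cs Cu Cs0 Cu0 eng_s eng_u CA HCA'
  c delta c0 delta0 HA'.
exists (K `^ q^-1)%R => f [mf _].
pose f' : L -> \bar R := (fun x => `|f x|%:E) \_ Omega.
have mf' : measurable_fun setT f'.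
  apply/(measurable_restrictT _ mOmega); apply/measurable_EFinP.
  exact: (measurableT_comp (@normr_measurable R setT) mf).
have f'0 x : 0 <= f' x by rewrite /f' patchE; case: ifPn.
have := HK f' mf' f'0.
have <- : \int[mu]_(x in Omega) (`|maximal_op Omega beta f x| `^ q * u x) =
    \int[mu]_(x in Omega) (sup_over F B (avg mu B (fun Q => fine (mu (cube Q)))
      (cst 1) f') x `^ q * u' x).
  apply: eq_integral => x /set_mem Ox; rewrite gee0_abs ?maximal_ge0// maximalE.
  by rewrite /u' patchE mem_set.
have <- : \int[mu]_(x in Omega) ((`|f x| `^ p)%:E * v x) =
    \int[mu]_x (f' x `^ p * (s x `^ (1 - p))%:E).
  rewrite vE; last 2 first.
  - apply/measurable_EFinP; apply: (measurableT_comp (measurable_powR _)).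
    exact: (measurableT_comp (@normr_measurable R setT) mf).
  - by move=> x; rewrite lee_fin powR_ge0.
  rewrite integral_mkcond; apply: eq_integral => x _; rewrite /f' !patchE.
  by case: ifPn => // _; rewrite poweR0r ?mul0e// gt_eqF.
set X := \int[mu]_(x in Omega) ((`|f x| `^ p)%:E * v x).
have X0 : 0 <= X.
  apply: integral_ge0 => x Ox; rewrite mule_ge0 ?lee_fin ?powR_ge0//.
  by case: wv => _ w0 _; exact: w0.
move=> H; apply: (@le_trans _ _ ((K%:E * X `^ (q / p)) `^ q^-1)).
  apply: lee_poweR => //; first by rewrite invr_ge0 ltW.
  apply: integral_ge0 => x Ox; rewrite mule_ge0 ?poweR_ge0//.
  by case: wu => _ w0 _; exact: w0.
by rewrite poweRM ?lee_fin ?poweR_ge0// -poweRrM mulrAC divff ?mul1r ?gt_eqF.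
Qed.

(** For [f = s 1_Q] one has [|f|^p v = s] almost everywhere on [Q], so the right-hand norm is
    [sigma(Q)^(1/p)], while the maximal function is at least [a = sigma(Q) / |Q|] on [Q]. The [p]-th
    power of the inequality reads [a^p u(Q)^(p/q) <= C'^p sigma(Q)], and one can divide by
    [sigma(Q)], which is positive and finite. *)
Lemma Apq_of_bounded : bounded_op Omega p q v u (maximal_op Omega beta) ->
  Apq_class Omega beta p q u v.
Proof.
move=> [C HC]; pose C' := Num.max 0%R C.
have C'0 : (0 <= C')%R by rewrite le_max lexx.
exists (C' `^ p)%R => Q FQ.
have vQ := fvol_gt0 FQ; have QO := cubeO FQ.
have Q0 : (0 < Q.2)%R by case: FQ => _ /andP[].
pose f (x : L) : R := (s x * \1_(B Q) x)%R.
have f0 x : (0 <= f x)%R by rewrite mulr_ge0 ?(ltW (s_gt0 x))// indicE.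
have mf : measurable_fun (Omega : set L) f.
  by apply: measurable_funTS; apply: measurable_funM.
rewrite sigmaE//; set m := \int[mu]_(x in cube Q) (s x)%:E.
have m_gt0 : 0 < m by exact: (integral_cube_gt0 ms s_gt0 Q0).
have mE : m = (fine m)%:E by rewrite fineK// ge0_fin_numE ?s_fin// ltW.
have fm0 : (0 < fine m)%R by rewrite -lte_fin -mE.
have fvE : \int[mu]_(x in Omega) ((`|f x| `^ p)%:E * v x) = m.
  rewrite vE; last 2 first.
  - apply/measurable_EFinP; apply: (measurableT_comp (measurable_powR _)).
    exact: (measurableT_comp (@normr_measurable R setT) mf).
  - by move=> x; rewrite lee_fin powR_ge0.
  rewrite /m -[in RHS](setIidr QO) integral_mkcondr.
  apply: eq_integral => x _; rewrite patchE /f indicE.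
  case: ifPn => Qx; last by rewrite mulr0 normr0 powR0 ?mul0e// gt_eqF.
  rewrite mulr1 gtr0_norm// -EFinM -powRD ?subrKC ?powRr1// ?ltW//.
  by rewrite oner_eq0.
have fLp : Lp_weight Omega p v f by split=> //; rewrite fvE mE ltry.
have := HC f fLp; rewrite fvE.
set I := \int[mu]_(x in Omega) _ => HI.
have mI : measurable_fun (Omega : set L)
    (fun x => `|maximal_op Omega beta f x| `^ q * u x).
  apply: emeasurable_funM; last by case: wu.
  apply: (measurableT_comp (measurable_poweR _)).
  apply: (measurableT_comp (@abse_measurable R setT)); rewrite maximalE.
  apply: measurable_funTS; apply: measurable_sup_over; first exact: mcube.
  exact: cube_lindelof.
have u0 x : Omega x -> 0 <= u x by case: wu => _ w0 _; exact: w0.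
set U := wmeas u (cube Q).
have U0 : 0 <= U by apply: integral_ge0 => x /QO; exact: u0.
set a := (fine m / fine (mu (cube Q)))%R.
have a0 : (0 < a)%R by rewrite divr_gt0.
have UI : (a `^ q)%:E * U <= I.
  rewrite /U /wmeas -ge0_integralZl ?lee_fin ?powR_ge0//; last 2 first.
  - by case: wu => mw _ _; exact: measurable_funS mw.
  - by move=> x /QO; exact: u0.
  apply: (@le_trans _ _ (\int[mu]_(x in cube Q)
      (`|maximal_op Omega beta f x| `^ q * u x))); last first.
    apply: ge0_subset_integral => // x Ox; rewrite mule_ge0 ?poweR_ge0// u0//.
  apply: (ge0_le_integral _ (mcube Q)).
  - by move=> x /QO Ox; apply: mule_ge0; [rewrite lee_fin powR_ge0|exact: u0].
  - apply: emeasurable_funM; first exact: measurable_cst.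
    by case: wu => mw _ _; exact: (measurable_funS mOmega QO mw).
  - exact: (measurable_funS mOmega QO mI).
  move=> x Qx; apply: lee_wpmul2r; first by apply: u0; exact: QO.
  rewrite -poweR_EFin lee_poweR ?(ltW q_gt0) ?lee_fin ?(ltW a0)//.
  rewrite gee0_abs ?maximal_ge0//; last exact: QO.
  apply: (@le_trans _ _ ((mu (cube Q))^-1 * \int[mu]_(y in cube Q) `|f y|%:E)); last first.
    by apply: ereal_sup_ubound; exists Q.
  rewrite {1}volE inver gt_eqF// (_ : \int[mu]_(y in cube Q) `|f y|%:E = m).
    by rewrite mE -EFinM lee_fin /a mulrC.
  apply: eq_integral => y Qy; rewrite /f indicE Qy mulr1 gtr0_norm//.
have {}HI : ((a `^ q)%:E * U) `^ q^-1 <= C'%:E * m `^ p^-1.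
  apply: le_trans (le_trans (lee_poweR _ _ UI) (le_trans HI _)).
  - by [].
  - by rewrite invr_ge0 ltW.
  - by rewrite mule_ge0// lee_fin powR_ge0.
  - by rewrite lee_wpmul2r ?poweR_ge0// lee_fin le_max lexx orbT.
have : (((a `^ q)%:E * U) `^ q^-1) `^ p <= (C'%:E * m `^ p^-1) `^ p.
  by apply: lee_poweR; rewrite ?poweR_ge0// ltW.
rewrite -poweRrM (poweRM p) ?lee_fin ?poweR_ge0// -[in X in _ <= X]poweRrM.
rewrite mulVf ?gt_eqF// poweRe1; last exact: ltW.
rewrite poweRM ?lee_fin ?powR_ge0// poweR_EFin -powRrM mulrA divff ?gt_eqF// mul1r.
rewrite (mulrC q^-1%R) mE volE inver gt_eqF// => H.
(* One factor [a] of [a^p], divided by [sigma(Q)], is [1 / |Q|]; the other [p - 1] form the second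
   factor of the A_{p,q} quotient. *)
have -> : U `^ (p / q) * (fine (mu (cube Q)))^-1%:E *
    ((fine m)%:E * (fine (mu (cube Q)))^-1%:E) `^ (p - 1) =
    (fine m)^-1%:E * ((a `^ p)%:E * U `^ (p / q)).
  rewrite -[in X in X `^ (p - 1)]EFinM -/a poweR_EFin -(mulr_powRB1 (ltW a0) p_gt0).
  rewrite muleA -EFinM -muleA -EFinM muleC; congr (_%:E * _).
  by rewrite /a mulrA mulrA mulVf ?gt_eqF// mul1r.
by rewrite lee_pdivrMl// [leRHS]muleC -poweR_EFin.
Qed.

End characterization.

Theorem theorem1p15 (R : realType) (n : nat) (Omega : set 'rV[R]_n.+1)
    (p q beta : R) (u v : 'rV[R]_n.+1 -> \bar R) :
  open Omega -> Omega !=set0 -> Omega <> setT ->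
  1 < p -> p <= q -> 0 < beta -> beta < 1 ->
  weight Omega u -> weight Omega v ->
  D_class Omega beta (sigma_weight p v) ->
  D_class Omega beta u ->
  Ainfty_class Omega beta (sigma_weight p v) ->
  bounded_op Omega p q v u (maximal_op Omega beta) <->
  Apq_class Omega beta p q u v.
Proof.
move=> oO O0 OT p1 pq b0 b1 wu wv Ds Du As; have [ws _] := Ds.
have [s [Z [ms s0 mZ nZ sZ]]] := sigma_weight_density oO O0 OT b0 b1 p1 wv ws.
split; first exact: (Apq_of_bounded oO OT b0 b1 p1 pq wu wv ws ms s0 mZ nZ sZ).
move=> HA.
exact: (bounded_of_Apq oO OT b0 b1 p1 pq wu wv ws ms s0 mZ nZ sZ Ds Du As HA).
Qed.
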